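(* Let $\mathcal A=\{A_1,\dots,A_m\}$ be an irreducible finite family of real $d\times d$ matrices that has a unique dominant product, whose leading eigenvalue $\lambda$ is unique and simple, is non-real, and has a rational $\mathrm{mod}\ \pi$ argument. Then $\mathcal A$ has infinitely many invariant bodies (counted up to multiplication by a positive constant), one of which is a convex hull of several (finitely many) ellipses.
   Context: Family: $\mathcal A=\{A_1,\dots,A_m\}$, $m\ge 1$, is irreducible if the matrices $A_i$ share no common invariant linear subspace other than $\{0\}$ and $\mathbb R^d$. $\mathcal A^k$ is the set of all products of $k$ matrices from $\mathcal A$ (repetitions permitted), $\mathcal A^{\mathbb N}=\bigcup_{k\ge1}\mathcal A^k$; products are regarded as words, $|\Pi|$ is the length of the product $\Pi$. $\rho(S)$ is the spectral radius of a matrix $S$; the joint spectral radius is $\rho(\mathcal A)=\lim_{n\to\infty}\max_{\Pi\in\mathcal A^n}\|\Pi\|^{1/n}$. Put $\nu(\Pi)=\rho(\Pi)^{1/|\Pi|}$. A convex body is a convex compact set with nonempty interior; convex bodies are assumed symmetric about the origin, and ellipses are centered at the origin (an ellipse is a set $\{a\cos t+b\sin t: t\in\mathbb R\}$ with $a,b\in\mathbb R^d$). A convex body $G\subset\mathbb R^d$ is invariant for $\mathcal A$ if $\mathrm{co}\bigl(\bigcup_{i=1}^m A_iG\bigr)=\rho(\mathcal A)\,G$. A product is primitive if it is not a power of a shorter product. A set $\mathcal P\subset\mathcal A^{\mathbb N}$ is a set of dominant products if: (1) all its elements are primitive and none is a cyclic permutation of another; (2) there is $q$ with $\nu(\Pi)=q$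 for all $\Pi\in\mathcal P$; (3) there is $\varepsilon>0$ such that every $S\in\mathcal A^{\mathbb N}$ satisfies $\nu(S)\le(1-\varepsilon)^{1/|S|}q$ unless $S$ is a power of some product from $\mathcal P$ or of one of its cyclic permutations. $\mathcal A$ has a unique dominant product $\Pi$ if $\mathcal P=\{\Pi\}$ is a set of dominant products. A leading eigenvalue of a matrix is an eigenvalue of largest modulus. It is unique and simple if $\lambda$ is not multiple and all other eigenvalues, except for $\bar\lambda$ when $\lambda\notin\mathbb R$, are strictly smaller in modulus. For $\lambda=|\lambda|e^{i\varphi}$ the argument is rational $\mathrm{mod}\ \pi$ if $\varphi/\pi\in\mathbb Q$. *)

(* Defs.v *)
From mathcomp Require Import all_boot all_order all_algebra.
From mathcomp Require Import complex.
From mathcomp Require Import all_classical all_reals all_analysis.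

Set Implicit Arguments.
Unset Strict Implicit.
Unset Printing Implicit Defensive.

Import Order.TTheory GRing.Theory Num.Theory.
Import numFieldNormedType.Exports.

Local Open Scope classical_set_scope.
Local Open Scope ring_scope.

Section Spectrum.
Variables (R : realType) (d : nat).
Implicit Type S : 'M[R]_d.

Definition complexify S : 'M[R[i]]_d := map_mx (real_complex R) S.

Definition spectral_radius S : R :=
  sup [set Normc.normc z | z in [set z | eigenvalue (complexify S) z]].

Definition leading_eigenvalue S (l : R[i]) : Prop :=
  eigenvalue (complexify S) l /\
  forall z, eigenvalue (complexify S) z -> Normc.normc z <= Normc.normc l.

(* When l is real, conjc l = l, so the exclusion of conjc l only has an effect
   for non-real l. Simplicity is algebraic: l is a simple root of the
   characteristic polynomial. *)
Definition unique_simple_leading S (l : R[i]) : Prop :=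
  [/\ leading_eigenvalue S l,
      mup l (char_poly (complexify S)) = 1%N &
      forall z, eigenvalue (complexify S) z -> z != l -> z != conjc l ->
        Normc.normc z < Normc.normc l].

End Spectrum.

Definition rational_mod_pi_arg (R : realType) (l : R[i]) : Prop :=
  exists phi : R,
    l = (Normc.normc l * cos phi +i* (Normc.normc l * sin phi))%C /\
    exists r : rat, phi / pi = ratr r.

Section Words.
Variable T : Type.
Implicit Types v w : seq T.

Definition word_power v (k : nat) : seq T := flatten (nseq k v).

Definition primitive w : Prop :=
  ~ exists v k, (size v < size w)%N /\ w = word_power v k.

Definition cyclic_perm v w : Prop := exists k, w = rot k v.

End Words.

Section Family.
Variables (R : realType) (d m : nat) (A : 'I_m -> 'M[R]_d).
Implicit Types w S : seq 'I_m.

Definition irreducible_family : Prop :=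
  forall V : {vspace 'cV[R]_d},
    (forall i v, v \in V -> A i *m v \in V) -> V = 0%VS \/ V = fullv.

(* Products are words in the indices; only nonempty words belong to A^N. *)
Definition word_prod w : 'M[R]_d := \big[mulmx/1%:M]_(i <- w) A i.

(* `|_| is the library norm on matrices (largest absolute value of an entry);
   by equivalence of norms the limit does not depend on this choice. The value
   at n = 0 is irrelevant. *)
Definition joint_spectral_radius : R :=
  lim ((fun n : nat =>
    \big[Num.max/0]_(w : n.-tuple 'I_m) `|word_prod w| `^ n%:R^-1) @ \oo).

Definition nu w : R := spectral_radius (word_prod w) `^ (size w)%:R^-1.

(* The bound e < 1 keeps the base of the real power 1 - e positive:
   powR takes junk values on negative bases. *)
Definition dominant_products (P : set (seq 'I_m)) : Prop :=
  [/\ forall w, P w -> w <> [::],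
      (forall w, P w -> primitive w) /\
      (forall v w, P v -> P w -> v <> w -> ~ cyclic_perm v w) &
      exists q : R,
        (forall w, P w -> nu w = q) /\
        exists e : R, [/\ 0 < e, e < 1 &
          forall S, S <> [::] ->
            ~ (exists w v k, [/\ P w, cyclic_perm w v & S = word_power v k]) ->
            nu S <= (1 - e) `^ (size S)%:R^-1 * q]].

Definition unique_dominant_product w : Prop := dominant_products [set w].

End Family.

Section Bodies.
Variables (R : realType) (d : nat).
Implicit Type G : set 'cV[R]_d.

Definition convex_hull G : set 'cV[R]_d := smallest (@convex_set R 'cV[R]_d) G.

Definition dilate (c : R) G : set 'cV[R]_d := [set c *: x | x in G].

Definition symmetric_convex_body G : Prop :=
  [/\ @convex_set R 'cV[R]_d G, compact G, G° !=set0 &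
      forall x, G x -> G (- x)].

Definition ellipse (a b : 'cV[R]_d) : set 'cV[R]_d :=
  [set cos t *: a + sin t *: b | t in [set: R]].

Definition homothety_class G : set (set 'cV[R]_d) :=
  [set H | exists2 c : R, 0 < c & H = dilate c G].

Definition invariant_body (m : nat) (A : 'I_m -> 'M[R]_d) G : Prop :=
  symmetric_convex_body G /\
  convex_hull (\bigcup_i (mulmx (A i) @` G)) =
    dilate (joint_spectral_radius A) G.

Definition hull_of_ellipses G : Prop :=
  exists (n : nat) (a b : 'I_n -> 'cV[R]_d),
    G = convex_hull (\bigcup_i ellipse (a i) (b i)).

End Bodies.

(* Main.v *)
From HB Require Import structures.
Require Import Defs.
From mathcomp Require Import all_boot all_order all_algebra.
From mathcomp Require Import complex.
From mathcomp Require Import all_classical all_reals all_analysis.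
From mathcomp Require Import perm zify ring lra.
Import Order.TTheory GRing.Theory Num.Theory.
Import numFieldNormedType.Exports.
Local Open Scope classical_set_scope.
Local Open Scope ring_scope.
Set Implicit Arguments.
Unset Strict Implicit.
Unset Printing Implicit Defensive.

(* Divide the family by [nu A w]. Then every product has spectral radius at most 1,
   so its trace is at most d in modulus; the trace form is nondegenerate on the
   algebra spanned by an irreducible semigroup, so the products are bounded and
   the joint spectral radius is 1. The argument being rational, the powers of some
   power of the product of [w] tend to the projection P onto its leading plane.
   If S is not a power of [w], then no w^a S w^b is a power of a rotation of [w],
   and |det(1 - X)| is bounded below for X in the semigroup generated by the
   matrices P S P. By the pigeonhole principle two of the partial products of a
   long product X of such matrices nearly agree, which forces X to be small. This
   yields a polytope in the leading plane that is preserved by [w] and mapped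
   strictly into itself by every P S. By a second pigeonhole argument finitely
   many of its images under products have an invariant convex hull. This body is
   mapped onto the polytope by P, and the polytope can be varied without becoming
   homothetic to the original one. *)

(** * Words *)

(** The obstacle is that the gap bounds the spectral radius of each product separately, whereas a
    body needs norms of products. Two polynomial functions transfer the information. Traces give
    boundedness. A lower bound on [\det (1 - Y)] gives, through the adjugate, a bound on the inverse
    of [1 - Y]: if [Y] nearly fixes [Q], then [Q] is small. Nearly equal partial products [Y *m Q]
    and [Q] are exactly this situation. The gap does not apply to powers of rotations of [w], so
    high powers of [w] are inserted between the factors: they converge to [P], and primitivity keeps
    the resulting word from being such a power. Rationality of the argument also makes orbits of [w]
    in the plane finite, so that the bodies can be polytopes, that is, hulls of degenerate
    ellipses. *)

Section WordCombinatorics.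
Variable T : eqType.
Implicit Types (u v w x y r p e s S : seq T) (ss : seq (seq T)).

Lemma word_powerS v k : word_power v k.+1 = v ++ word_power v k.
Proof. by []. Qed.

Lemma word_powerD v a b :
  word_power v (a + b) = word_power v a ++ word_power v b.
Proof. by rewrite /word_power nseqD flatten_cat. Qed.

Lemma word_power1 v : word_power v 1 = v.
Proof. by rewrite /word_power /= cats0. Qed.

Lemma size_word_power v k : size (word_power v k) = (k * size v)%N.
Proof. by elim: k => // k IH; rewrite word_powerS size_cat IH mulSn. Qed.

(** As [rot q w] is [drop q w ++ take q w], a power of a rotation of [w] contains a power of [w]
    with exponent one less. *)
Lemma word_power_rot p e k :
  word_power (e ++ p) k.+1 = e ++ word_power (p ++ e) k ++ p.
Proof.
elim: k => [|k IH]; first by rewrite word_power1.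
by rewrite word_powerS IH word_powerS -!catA.
Qed.

Lemma cat_inj_size x y u v : size x = size u -> x ++ y = u ++ v -> x = u /\ y = v.
Proof.
move=> sxu e; split.
  by have := congr1 (take (size x)) e; rewrite take_size_cat // sxu take_size_cat.
by have := congr1 (drop (size x)) e; rewrite drop_size_cat // sxu drop_size_cat.
Qed.

(** Euclid's algorithm on lengths: the shorter word is a prefix of the longer one, and what is left
    after removing it still commutes with the shorter. *)
Lemma commuting_words x y : x ++ y = y ++ x ->
  exists u a b, x = word_power u a /\ y = word_power u b.
Proof.
have [n] := ubnP (size x + size y); elim: n x y => // n IH x y lt.
wlog le : x y lt / (size x <= size y)%N.
  move=> H; case: (leqP (size x) (size y)) => [|/ltnW] le; first exact: H.
  move=> /esym /H; rewrite addnC => /(_ lt le) [u [a [b [-> ->]]]].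
  by exists u, b, a.
case: x => [|t x] in lt le *.
  by move=> _; exists y, 0%N, 1%N; rewrite word_power1.
set z := t :: x in lt le * => e.
have ey : y = z ++ drop (size z) y.
  have := congr1 (take (size z)) e.
  by rewrite take_size_cat // takel_cat // => {1}->; rewrite cat_take_drop.
move: e; rewrite ey -catA => /(cat_inj_size erefl) [_ e].
have [|u [a [b [za yb]]]] := IH _ _ _ e.
  by move: lt; rewrite {1}ey size_cat /=; lia.
by exists u, a, (a + b)%N; rewrite word_powerD -za -yb.
Qed.


(* The words that are not powers of [w]; only these are contracted by [P]. *)
Definition nontrivial w S := forall k, S <> word_power w k.

Lemma nontrivial_catr w a S : nontrivial w S -> nontrivial w (S ++ word_power w a).
Proof.
move=> ntS k /[dup] e /(congr1 size); rewrite size_cat !size_word_power => es.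
have [ak|ka] := leqP a k.
  have ss : size S = size (word_power w (k - a)).
    by rewrite size_word_power; nia.
  move: e; rewrite -[in X in _ = X](subnK ak) word_powerD => /(cat_inj_size ss) [].
  by move/ntS.
have S0 : size S = 0%N by nia.
by move: (ntS 0%N); rewrite (size0nil S0).
Qed.

(** A primitive word occurs in its powers only at multiples of its length. Once whole copies of [w]
    are removed from [S], the rest commutes with its complement in [w]; if nonempty, it would make
    [w] a power of a shorter word. *)
Lemma primitive_prefix w S r k : primitive w ->
  S ++ w ++ r = word_power w k -> exists j, S = word_power w j.
Proof.
move=> pw; elim: k S => [|k IH] S e.
  by exists 0%N; have /eqP := congr1 size e; rewrite size_cat addn_eq0 => /andP[/eqP/size0nil].
have [wS|Sw] := leqP (size w) (size S).
  have eS : S = w ++ drop (size w) S.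
    have := congr1 (take (size w)) e.
    rewrite word_powerS takel_cat // take_size_cat // => {1}<-.
    by rewrite cat_take_drop.
  move: e; rewrite eS word_powerS -catA => /(cat_inj_size erefl) [_] /IH [j Sj].
  by exists j.+1; rewrite word_powerS -Sj.
have [S0|S0] := posnP (size S); first by exists 0%N; rewrite (size0nil S0).
set e' := drop (size S) w.
have ew : w = S ++ e'.
  have := congr1 (take (size S)) e.
  rewrite word_powerS take_size_cat // takel_cat 1?ltnW // => {1}->.
  by rewrite cat_take_drop.
case: k IH e => [|k] IH.
  move/(congr1 size); rewrite word_power1 !size_cat; lia.
rewrite word_powerS {2}ew -catA => /(cat_inj_size erefl) [_].
rewrite word_powerS [in X in _ = X]ew -catA catA.
have sz : size w = size (e' ++ S) by rewrite ew !size_cat addnC.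
move=> /(cat_inj_size sz) [e1 _].
have [u [a [b [Sa eb]]]] : exists u a b, S = word_power u a /\ e' = word_power u b.
  by apply: commuting_words; rewrite -ew.
case: pw; exists u, (a + b)%N; split; last by rewrite word_powerD -Sa -eb.
by case: a Sa => [|a] Sa; move: S0 Sw; rewrite Sa // word_powerS size_cat; lia.
Qed.

(* The first block [s] sits between two copies of [w] in a power of [w], at a
   position that primitivity forces to be a multiple of [size w]. *)
Lemma interleaved_not_power w a ss v k : w <> [::] -> primitive w ->
  (0 < a)%N -> (0 < size ss)%N -> (forall s, s \in ss -> nontrivial w s) ->
  cyclic_perm w v ->
  word_power w a ++ flatten [seq s ++ word_power w a | s <- ss]
    <> word_power v k.
Proof.
move=> w0 pw a0 ss0 nt [j ->]; case: a a0 => // a _.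
have sw : (0 < size w)%N by case: (w) w0.
case: k => [|k]; first by case: (w) w0.
rewrite !word_powerS -catA => e.
(* The first [size w] letters of both sides identify the rotation with [w] itself. *)
have [er] := cat_inj_size (esym (size_rot j w)) e; rewrite -er => {}e.
case: ss ss0 nt e => // s ss _ nt /=.
rewrite -catA => e.
have ak : (a <= k)%N.
  by have := congr1 size e; rewrite !size_cat !size_word_power; nia.
move: e; rewrite -(subnKC ak) word_powerD => /(cat_inj_size erefl) [_].
rewrite /= -!catA => /(primitive_prefix pw) [b].
by apply: nt; exact: mem_head.
Qed.

End WordCombinatorics.

(** * Spectra *)

Lemma trig_mx_mul (F : fieldType) n (X Y : 'M[F]_n) :
  is_trig_mx X -> is_trig_mx Y ->
  is_trig_mx (X *m Y) /\ forall i, (X *m Y) i i = X i i * Y i i.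
Proof.
move=> /is_trig_mxP tX /is_trig_mxP tY; split.
  apply/is_trig_mxP => i j ij; rewrite mxE big1 // => k _.
  have [ik|ki] := ltnP i k; first by rewrite tX ?mul0r.
  by rewrite [Y k j]tY ?mulr0 // (leq_ltn_trans ki).
move=> i; rewrite mxE (bigD1 i) //= big1 ?addr0 // => k.
rewrite neq_ltn => /orP[ki|ik]; first by rewrite tY ?mulr0.
by rewrite tX ?mul0r.
Qed.

Lemma char_poly_conj (F : fieldType) n (A P : 'M[F]_n) : P \in unitmx ->
  char_poly (P *m A *m invmx P) = char_poly A.
Proof.
move=> Pu; rewrite /char_poly.
have -> : char_poly_mx (P *m A *m invmx P) =
    map_mx polyC P *m char_poly_mx A *m map_mx polyC (invmx P).
  rewrite /char_poly_mx mulmxBr mulmxBl -!map_mxM; congr (_ - _).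
  by rewrite scalar_mxC -mulmxA -map_mxM mulmxV // map_mx1 mulmx1.
rewrite !det_mulmx mulrAC -!det_mulmx -map_mxM mulmxV // map_mx1.
by rewrite det_mulmx det1 mul1r.
Qed.

Lemma spectrum_of_trig (F : fieldType) n (A P : 'M[F]_n.+1) : P \in unitmx ->
  is_trig_mx (P *m A *m invmx P) -> exists t : 'I_n.+1 -> F,
  char_poly A = \prod_i ('X - (t i)%:P) /\
  forall k, \tr (A ^+ k) = \sum_i t i ^+ k.
Proof.
move=> Pu tt; exists (fun i => (P *m A *m invmx P) i i); split.
  by rewrite -char_poly_trig // char_poly_conj.
move=> k; move: tt; set t := P *m A *m invmx P => tt.
have [tk tkE] : is_trig_mx (t ^+ k) /\ forall i, (t ^+ k) i i = t i i ^+ k.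
  elim: k => [|k [IH IHe]].
    split; first by apply/is_trig_mxP => i j ij; rewrite !mxE -val_eqE ltn_eqF.
    by move=> i; rewrite !mxE eqxx !expr0.
  have [h1 h2] := trig_mx_mul tt IH.
  by rewrite exprS; split=> // i; rewrite h2 IHe -exprS.
have tkP : t ^+ k *m P = P *m A ^+ k.
  elim: k {tk tkE} => [|k IH]; first by rewrite !expr0 mulmx1 mul1mx.
  rewrite !exprS -mulmxE -mulmxA IH /t !mulmxA; congr (_ *m _).
  by rewrite -(mulmxA (P *m A)) mulVmx // mulmx1.
have -> : A ^+ k = invmx P *m (t ^+ k *m P).
  by rewrite tkP mulmxA mulVmx // mul1mx.
rewrite mxtrace_mulC -mulmxA mulmxV // mulmx1.
by apply: eq_bigr => i _; rewrite tkE.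
Qed.

Section Triangularization.
Variables (R : realType) (d' : nat).
Local Notation d := d'.+1.
Implicit Type M : 'M[R]_d.
Local Notation C := R[i].

(** Schur triangularization lists the eigenvalues with multiplicity on a diagonal. Traces of powers
    and [\det (1 - M)], the characteristic polynomial at 1, are read off from the same list. *)
Lemma spectrum_enumeration M : exists t : 'I_d -> C,
  [/\ char_poly (complexify M) = \prod_i ('X - (t i)%:P),
      forall z, eigenvalue (complexify M) z = [exists i, z == t i],
      forall k, (\tr (M ^+ k))%:C%C = \sum_i t i ^+ k &
      (\det (1 - M))%:C%C = \prod_i (1 - t i)].
Proof.
have [P Pu] := Schur (complexify M) (ltn0Sn d').
have {}Pu := unitarymx_unit Pu.
rewrite /similar_to conjumx // => /(spectrum_of_trig Pu) [t [charM trM]].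
exists t; split => //.
- move=> z; rewrite eigenvalue_root_char charM /root horner_prod prodf_seq_eq0.
  apply/hasP/existsP => [[i _]|[i /eqP->]].
    by rewrite /= hornerXsubC subr_eq0; exists i.
  by exists i; rewrite ?mem_index_enum //= hornerXsubC subrr.
- move=> k; rewrite -trM /complexify -rmorphXn /= /mxtrace raddf_sum /=.
  by apply: eq_bigr => i _; rewrite mxE.
- have -> : (\det (1 - M))%:C%C = (char_poly (complexify M)).[1].
    rewrite -det_map_mx /= rmorphB /= rmorph1 /char_poly.
    rewrite -[RHS]/(horner_eval 1 _) -det_map_mx /=; congr (\det _).
    apply/matrixP => i j; rewrite !mxE /= /horner_eval hornerD hornerN hornerC.
    by rewrite hornerMn hornerX.
  rewrite charM horner_prod; apply: eq_bigr => i _.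
  by rewrite hornerXsubC.
Qed.

End Triangularization.

Section SpectralRadius.
Variables (R : realType) (d' : nat).
Local Notation d := d'.+1.
Implicit Type M : 'M[R]_d.
Local Notation C := R[i].
Local Notation normc := Normc.normc.

Lemma normcE_norm (z : C) : `|z| = (normc z)%:C%C.
Proof. by []. Qed.

Lemma normc_real (x : R) : normc x%:C%C = `|x|.
Proof. by rewrite /normc /= expr0n addr0 sqrtr_sqr. Qed.

Lemma normc_ge0 (z : C) : 0 <= normc z.
Proof. by case: z => a b; exact: sqrtr_ge0. Qed.

Lemma normcX (z : C) k : normc (z ^+ k) = normc z ^+ k.
Proof.
by elim: k => [|k IH]; rewrite ?expr0 ?Normc.normc1 // !exprS Normc.normcM IH.
Qed.

Lemma normc_sum (I : finType) (f : I -> C) :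
  normc (\sum_i f i) <= \sum_i normc (f i).
Proof.
rewrite -lecR -normcE_norm (le_trans (ler_norm_sum _ _ _)) //.
by rewrite rmorph_sum /=.
Qed.

Lemma normc_prod (I : finType) (f : I -> C) :
  normc (\prod_i f i) = \prod_i normc (f i).
Proof. by apply: (big_morph _ (@Normc.normcM R)); exact: Normc.normc1. Qed.

Lemma le_spectral_radius M z : eigenvalue (complexify M) z ->
  normc z <= spectral_radius M.
Proof.
have [t [_ tE _ _]] := spectrum_enumeration M.
move=> ez; apply: ub_le_sup; last by exists z.
(* An upper bound of the spectrum is needed for [sup] not to take its default value. *)
exists (\sum_i normc (t i)) => _ [y /= + <-].
rewrite tE => /existsP[i /eqP ->].
by rewrite (bigD1 i) //= lerDl sumr_ge0 // => *; exact: normc_ge0.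
Qed.

Lemma spectral_radius_le M r :
  (forall z, eigenvalue (complexify M) z -> normc z <= r) ->
  spectral_radius M <= r.
Proof.
have [t [_ tE _ _]] := spectrum_enumeration M.
move=> h; apply: ge_sup; last by move=> _ [y /= ey <-]; exact: h.
exists (normc (t ord0)), (t ord0) => //=.
by rewrite tE; apply/existsP; exists ord0.
Qed.

Lemma spectral_radius_ge0 M : 0 <= spectral_radius M.
Proof.
have [t [_ tE _ _]] := spectrum_enumeration M.
apply: le_trans (normc_ge0 (t ord0)) _; apply: le_spectral_radius.
by rewrite tE; apply/existsP; exists ord0.
Qed.

Lemma spectral_radius_leading M l : leading_eigenvalue M l ->
  spectral_radius M = normc l.
Proof.
move=> [el ml]; apply/eqP; rewrite eq_le le_spectral_radius // andbT.
exact: spectral_radius_le.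
Qed.

Lemma spectral_radiusZ_le M (c : R) : 0 < c ->
  spectral_radius (c *: M) <= c * spectral_radius M.
Proof.
move=> c0; apply: spectral_radius_le => z /eigenvalueP [v vM v0].
have cz : z = c%:C%C * (z / c%:C%C).
  by rewrite mulrC divfK // fmorph_eq0 gt_eqF.
rewrite cz Normc.normcM normc_real gtr0_norm // ler_pM2l //.
apply: le_spectral_radius; apply/eigenvalueP; exists v => //.
have : c%:C%C *: (v *m complexify M) = z *: v.
  by rewrite -vM /complexify map_mxZ -scalemxAr.
move/(congr1 (fun x => c%:C%C^-1 *: x)).
rewrite !scalerA mulVf ?fmorph_eq0 ?gt_eqF // scale1r => ->.
by rewrite mulrC.
Qed.

Lemma trace_pow_le M k : `|\tr (M ^+ k)| <= d%:R * spectral_radius M ^+ k.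
Proof.
have [t [_ tE trE _]] := spectrum_enumeration M.
rewrite -normc_real trE (le_trans (normc_sum _)) //.
have -> : d%:R * spectral_radius M ^+ k = \sum_(i < d) spectral_radius M ^+ k.
  by rewrite sumr_const card_ord mulr_natl.
rewrite ler_sum // => i _.
rewrite normcX lerXn2r ?nnegrE ?normc_ge0 ?spectral_radius_ge0 //.
by apply: le_spectral_radius; rewrite tE; apply/existsP; exists i.
Qed.

(** The determinant is the product of the factors [1 - t i], each of modulus at least [e]. *)
Lemma det_one_sub_ge M e : spectral_radius M <= 1 - e -> 0 <= e ->
  e ^+ d <= `|\det (1 - M)|.
Proof.
have [t [_ tE _ detE]] := spectrum_enumeration M => Me e0.
have -> : e ^+ d = \prod_(i < d) e by rewrite prodr_const card_ord.
rewrite -normc_real detE normc_prod.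
apply: ler_prod => i _; rewrite e0 /=.
have ti : normc (t i) <= 1 - e.
  by apply: le_trans Me; apply: le_spectral_radius; rewrite tE; apply/existsP; exists i.
rewrite lerBrDl in ti.
have : normc (1 : C) <= normc (1 - t i) + normc (t i).
  by rewrite -{1}[1](subrK (t i)); exact: le_normcD.
rewrite Normc.normc1; lra.
Qed.

End SpectralRadius.

(** * Matrix norms and limits *)

Section MatrixNorm.
Variable R : realType.

Lemma mx_entry_le m n (X : 'M[R]_(m, n)) i j : `|X i j| <= `|X|.
Proof.
by rewrite [in leRHS]/Num.norm /= mx_normrE (le_bigmax _ (fun ij => `|X ij.1 ij.2|) (i, j)).
Qed.

Lemma mx_norm_le m n (X : 'M[R]_(m, n)) c : 0 <= c ->
  (forall i j, `|X i j| <= c) -> `|X| <= c.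
Proof.
by move=> c0 h; rewrite /Num.norm /= mx_normrE; apply/bigmax_leP; split=> // -[i j] _ /=.
Qed.

Lemma mulmx_norm_le m n p (X : 'M[R]_(m, n)) (Y : 'M[R]_(n, p)) :
  `|X *m Y| <= n%:R * `|X| * `|Y|.
Proof.
apply: mx_norm_le => [|i j]; first by rewrite !mulr_ge0 ?normr_ge0.
rewrite mxE (le_trans (ler_norm_sum _ _ _)) //.
have -> : n%:R * `|X| * `|Y| = \sum_(k < n) (`|X| * `|Y|).
  by rewrite sumr_const card_ord -mulrA mulr_natl.
by apply: ler_sum => k _; rewrite normrM ler_pM ?mx_entry_le.
Qed.

(** One member of [E] is chosen in each occupied cell of a grid of side [e], so net points keep the
    structure of [E]. *)
Lemma finite_net m n (E : set 'M[R]_(m, n)) (c e : R) : 0 < e ->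
  (forall X, E X -> `|X| <= c) ->
  exists s : seq 'M[R]_(m, n), (forall X, X \in s -> E X) /\
    forall X, E X -> exists2 Y, Y \in s & `|X - Y| <= e.
Proof.
move=> e0 bE.
pose K := Num.truncn ((c + c) / e).
(* Adding [c] makes the entries nonnegative; [Num.truncn] sends all negative numbers to 0. *)
pose cell (X : 'M[R]_(m, n)) : {ffun 'I_m * 'I_n -> 'I_K.+1} :=
  [ffun ij => inord (Num.truncn ((X ij.1 ij.2 + c) / e))].
pose pick (t : {ffun 'I_m * 'I_n -> 'I_K.+1}) : option 'M[R]_(m, n) :=
  match pselect (exists X, E X /\ cell X = t) with
  | left h => Some (proj1_sig (cid h)) | right _ => None end.
exists (pmap pick (enum {ffun 'I_m * 'I_n -> 'I_K.+1})); split.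
  move=> X; rewrite mem_pmap => /mapP [t _]; rewrite /pick.
  by case: pselect => // h [->]; case: cid => ? [].
move=> X EX; have := erefl (pick (cell X)); rewrite {2}/pick.
case: pselect => [h|[]]; last by exists X.
case: cid => Y [EY cYX] /= pX; exists Y.
  by rewrite mem_pmap; apply/mapP; exists (cell X); rewrite ?mem_enum.
apply: mx_norm_le => [|i j]; first exact: ltW.
rewrite !mxE; move/ffunP/(_ (i, j)): cYX; rewrite !ffunE /= => /(congr1 val) /=.
have entry Z : E Z -> 0 <= (Z i j + c) / e /\
    (Num.truncn ((Z i j + c) / e) < K.+1)%N.
  move=> /bE /(le_trans (mx_entry_le Z i j)); rewrite ler_norml => /andP[l u].
  have p0 : 0 <= (Z i j + c) / e by apply: divr_ge0; [lra | exact: ltW].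
  split=> //; rewrite ltnS; apply: le_truncn.
  by rewrite ler_pM2r ?invr_gt0 // lerD2r.
have [x0 xK] := entry _ EX; have [y0 yK] := entry _ EY.
rewrite !inordK // => eXY.
have /andP[] := truncn_itv x0; have /andP[] := truncn_itv y0; rewrite eXY.
rewrite -addn1 natrD ler_pdivlMr // ltr_pdivrMr // => a1 a2 b1.
rewrite ltr_pdivrMr // => b2.
move: b1; rewrite ler_pdivlMr // => b1.
rewrite ler_norml; apply/andP; split; lra.
Qed.

Lemma det_norm_le n (X : 'M[R]_n) c : 0 <= c -> (forall i j, `|X i j| <= c) ->
  `|\det X| <= n`!%:R * c ^+ n.
Proof.
move=> c0 Xc; rewrite /determinant (le_trans (ler_norm_sum _ _ _)) //.
have -> : n`!%:R * c ^+ n = \sum_(s : 'S_n) c ^+ n.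
  by rewrite sumr_const card_Sn mulr_natl.
apply: ler_sum => s _; rewrite normrM normrX normrN1 expr1n mul1r normr_prod.
have -> : c ^+ n = \prod_(i < n) c by rewrite prodr_const card_ord.
by apply: ler_prod => i _; rewrite normr_ge0 Xc.
Qed.

(* [(1 - Y)^-1] is the adjugate of [1 - Y] over its determinant. *)
Lemma almost_fixed_le d p (Y : 'M[R]_d.+1) (Q : 'M[R]_(d.+1, p)) c eta : 0 < eta ->
  eta <= `|\det (1 - Y)| -> `|1 - Y| <= c ->
  `|Q| <= d.+1%:R * (d`!%:R * c ^+ d) / eta * `|Q - Y *m Q|.
Proof.
move=> eta0 hdet hc; have c0 : 0 <= c by apply: le_trans hc.
have adjc : `|\adj (1 - Y)| <= d`!%:R * c ^+ d.
  apply: mx_norm_le => [|i j]; first by rewrite mulr_ge0 // exprn_ge0.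
  rewrite mxE /cofactor normrM normrX normrN1 expr1n mul1r.
  apply: det_norm_le => // k k'; rewrite !mxE.
  by rewrite (le_trans _ hc) // (le_trans _ (mx_entry_le _ (lift j k) (lift i k'))) // !mxE.
have e1 : \adj (1 - Y) *m (Q - Y *m Q) = \det (1 - Y) *: Q.
  have <- : (1 - Y) *m Q = Q - Y *m Q by rewrite mulmxBl mul1mx.
  by rewrite mulmxA mul_adj_mx mul_scalar_mx.
rewrite mulrAC ler_pdivlMr //.
have := congr1 Num.norm e1; rewrite normrZ => e2.
have : `|\adj (1 - Y) *m (Q - Y *m Q)| <= d.+1%:R * (d`!%:R * c ^+ d) * `|Q - Y *m Q|.
  apply: le_trans (mulmx_norm_le _ _) _.
  by rewrite ler_wpM2r // ler_wpM2l.
by rewrite e2; apply: le_trans; rewrite mulrC ler_wpM2r.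
Qed.

End MatrixNorm.

Section MatrixConvergence.
Variable R : realType.

Definition mx_cvg m n (X_ : nat -> 'M[R]_(m, n)) (X : 'M[R]_(m, n)) :=
  forall i j, (fun k => X_ k i j) @ \oo --> X i j.

Lemma mx_cvg_cst m n (X : 'M[R]_(m, n)) : mx_cvg (fun=> X) X.
Proof. by move=> i j; exact: cvg_cst. Qed.

Lemma mx_cvgM m n p (X_ : nat -> 'M[R]_(m, n)) X (Y_ : nat -> 'M[R]_(n, p)) Y :
  mx_cvg X_ X -> mx_cvg Y_ Y -> mx_cvg (fun k => X_ k *m Y_ k) (X *m Y).
Proof.
move=> cX cY i j; under eq_fun do rewrite mxE; rewrite mxE.
apply: cvg_big => [|k _]; first exact: add_continuous.
exact: cvgM.
Qed.

Lemma mx_cvgB m n (X_ Y_ : nat -> 'M[R]_(m, n)) X Y :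
  mx_cvg X_ X -> mx_cvg Y_ Y -> mx_cvg (fun k => X_ k - Y_ k) (X - Y).
Proof.
move=> cX cY i j; under eq_fun do rewrite !mxE; rewrite !mxE.
exact: cvgB.
Qed.

Lemma det_cvg n (X_ : nat -> 'M[R]_n) X : mx_cvg X_ X ->
  (fun k => \det (X_ k)) @ \oo --> \det X.
Proof.
move=> cX; rewrite /determinant.
apply: cvg_big => [|s _]; first exact: add_continuous.
apply: cvgM; first exact: cvg_cst.
by apply: cvg_big => [|i _]; [exact: mul_continuous|exact: cX].
Qed.

Lemma mx_cvg_norm_le m n (X_ : nat -> 'M[R]_(m, n)) X c :
  mx_cvg X_ X -> (forall k, `|X_ k| <= c) -> `|X| <= c.
Proof.
move=> cX Xc; apply: mx_norm_le => [|i j]; first exact: le_trans (Xc 0%N).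
have h : (fun k => `|X_ k i j|) @ \oo --> `|X i j| by apply: cvg_norm.
rewrite -(cvg_lim (@Rhausdorff R) h); apply: limr_le; first by apply/cvg_ex; exists `|X i j|.
by apply: nearW => k; apply: le_trans (Xc k); exact: mx_entry_le.
Qed.

(** Index 0 is exempt because with zero copies of [w] inserted a word may be a power of a rotation
    of [w]. *)
Lemma mx_cvg_det_ge n (X_ : nat -> 'M[R]_n) X eta : mx_cvg X_ X ->
  (forall k, (0 < k)%N -> eta <= `|\det (X_ k)|) -> eta <= `|\det X|.
Proof.
move=> cX Xc; have h : (fun k => `|\det (X_ k)|) @ \oo --> `|\det X|.
  by apply: cvg_norm; exact: det_cvg.
rewrite -(cvg_lim (@Rhausdorff R) h); apply: limr_ge.
  by apply/cvg_ex; exists `|\det X|.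
by exists 1%N => // k /=; exact: Xc.
Qed.

Lemma mx_cvg_eventually m n (X_ : nat -> 'M[R]_(m, n)) X e : 0 < e ->
  mx_cvg X_ X -> exists k0, forall k, (k0 <= k)%N -> `|X_ k - X| <= e.
Proof.
move=> e0 cX.
have : \forall k \near \oo, forall ij : 'I_m * 'I_n, `|X_ k ij.1 ij.2 - X ij.1 ij.2| <= e.
  apply: filter_forall => -[i j] /=.
  by have /cvgr_distC_le := cX i j; apply.
move=> [k0 _ h]; exists k0 => k /h hk; apply: mx_norm_le => [|i j]; first exact: ltW.
by rewrite !mxE; exact: (hk (i, j)).
Qed.

End MatrixConvergence.

(** * Boundedness of irreducible semigroups *)

Section Spanning.
Variables (K : fieldType) (vT : vectType K).

Lemma span_closed (X : seq vT) (P : vT -> Prop) : P 0 ->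
  (forall a u v, P u -> P v -> P (a *: u + v)) ->
  (forall x, x \in X -> P x) -> forall v, v \in <<X>>%VS -> P v.
Proof.
move=> P0 PD PX v vX; rewrite (coord_span (X := in_tuple X) vX).
elim/big_ind: _ => // [x y Px Py|k _].
  by rewrite -[x]scale1r; exact: PD.
rewrite -[_ *: _]addr0; apply: PD => //; apply: PX; apply: mem_nth.
exact: ltn_ord.
Qed.

(** A list whose span has the largest possible dimension works: one more value cannot enlarge that
    span. *)
Lemma finite_spanning (T : Type) (f : T -> vT) :
  exists ss : seq T, forall t, f t \in <<map f ss>>%VS.
Proof.
pose P n := `[< exists ss, \dim <<map f ss>> = n >].
have exP : exists n, P n by exists (\dim <<map f [::]>>); apply/asboolP; exists [::].
have ubP n : P n -> (n <= \dim {:vT})%N.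
  by move=> /asboolP [ss <-]; apply: dimvS; exact: subvf.
case: (ex_maxnP exP ubP) => n /asboolP [ss dn] nmax; exists ss => t.
have sub : (<<map f ss>> <= <<map f (t :: ss)>>)%VS.
  by rewrite /= span_cons addvSr.
have : (\dim <<map f (t :: ss)>> <= \dim <<map f ss>>)%N.
  by rewrite dn; apply: nmax; apply/asboolP; exists (t :: ss).
rewrite (geq_leqif (dimv_leqif_sup sub)) => /subvP; apply.
by rewrite /= span_cons; apply: (subvP (addvSl _ _)); exact: memv_line.
Qed.

End Spanning.

Section TraceForm.
Variables (R : realType) (d' m : nat) (B : 'I_m -> 'M[R]_d'.+1).
Local Notation d := d'.+1.
Local Notation W := (word_prod B).
Hypothesis irrB : irreducible_family B.

Lemma word_prod_cons i v : W (i :: v) = B i *m W v.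
Proof. by rewrite /word_prod big_cons. Qed.

Lemma word_prod_nil : W [::] = 1%:M.
Proof. by rewrite /word_prod big_nil. Qed.

Lemma word_prod_cat u v : W (u ++ v) = W u *m W v.
Proof.
elim: u => [|i u IH]; first by rewrite word_prod_nil mul1mx.
by rewrite /= !word_prod_cons IH mulmxA.
Qed.

Lemma word_prod_power v k : W (word_power v k) = W v ^+ k.
Proof.
elim: k => [|k IH]; first by rewrite word_prod_nil.
by rewrite word_powerS word_prod_cat IH exprS.
Qed.

(** The span of the orbit is invariant, and it contains [v] through the empty word. *)
Lemma irreducible_span (v : 'cV[R]_d) : v != 0 ->
  exists ss, <<[seq W s *m v | s <- ss]>>%VS = fullv.
Proof.
move=> v0; have [ss sp] := finite_spanning (fun S => W S *m v).
exists ss; have [] := irrB (V := <<[seq W s *m v | s <- ss]>>%VS).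
- move=> i; apply: span_closed.
  + by rewrite mulmx0 mem0v.
  + by move=> a x y hx hy; rewrite mulmxDr -scalemxAr rpredD // rpredZ.
  + move=> _ /mapP [S _ ->]; rewrite mulmxA -word_prod_cons; exact: sp.
- move=> e; have := sp [::]; rewrite e memv0 word_prod_nil mul1mx.
  by rewrite (negPf v0).
- by [].
Qed.

(** By linearity [t i * p.[t i]] sums to 0 for every polynomial [p]. A [p] whose roots are the
    values other than 1 turns the sum into the number of ones times a nonzero factor, so in
    characteristic 0 there are no ones. *)
Lemma power_sums_eq0 (F : fieldType) n (t : 'I_n -> F) :
  [pchar F] =i pred0 -> (forall k, \sum_i t i ^+ k.+1 = 0) ->
  forall i, t i != 1.
Proof.
move=> ch0 h i; apply/negP => /eqP ti.
have hp (p : {poly F}) : \sum_i t i * p.[t i] = 0.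
  under eq_bigr do rewrite horner_coef mulr_sumr.
  rewrite exchange_big big1 // => k _ /=.
  under eq_bigr do rewrite mulrCA -exprS.
  by rewrite -mulr_sumr h mulr0.
have := hp (\prod_(j | t j != 1) ('X - (t j)%:P)).
rewrite (bigID (fun j => t j == 1)) /= addrC big1 ?add0r => [|j tj]; last first.
  by rewrite horner_prod (bigD1 j) //= hornerXsubC subrr mul0r mulr0.
under eq_bigr => j /eqP -> do rewrite mul1r.
rewrite sumr_const -mulr_natr => /eqP; rewrite mulf_eq0 => /orP[|].
  rewrite horner_prod => /prodf_eq0 [j tj].
  by rewrite hornerXsubC subr_eq0 eq_sym (negPf tj).
rewrite pcharf0P // in ch0; rewrite ch0 => /eqP c0.
have : (t i == 1) = false := card0_eq c0 i; by rewrite ti eqxx.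
Qed.

(** If [X *m v] is nonzero, irreducibility gives [Y] in the algebra with [Y *m (X *m v) = v], so
    [Y *m X] has eigenvalue 1. By cyclicity the traces of its positive powers vanish, which excludes
    that eigenvalue. *)
Lemma trace_form_nondegenerate (ss : seq (seq 'I_m)) X :
  (forall S, W S \in <<map W ss>>%VS) -> X \in <<map W ss>>%VS ->
  (forall S, \tr (X *m W S) = 0) -> X = 0.
Proof.
move=> sp XA trX; apply/eqP/negPn/negP => X0.
set V := <<map W ss>>%VS in sp XA.
have mulV Y1 Y2 : Y1 \in V -> Y2 \in V -> Y1 *m Y2 \in V.
  move=> h1 h2; move: Y1 h1; apply: span_closed.
  - by rewrite mul0mx mem0v.
  - by move=> a x y hx hy; rewrite mulmxDl -scalemxAl rpredD // rpredZ.
  move=> _ /mapP [S1 _ ->]; move: Y2 h2; apply: span_closed.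
  - by rewrite mulmx0 mem0v.
  - by move=> a x y hx hy; rewrite mulmxDr -scalemxAr rpredD // rpredZ.
  by move=> _ /mapP [S2 _ ->]; rewrite -word_prod_cat.
have trV Y : Y \in V -> \tr (X *m Y) = 0.
  move: Y; apply: (span_closed (P := fun Y => \tr (X *m Y) = 0)).
  - by rewrite mulmx0 mxtrace0.
  - by move=> a x y hx hy; rewrite mulmxDr -scalemxAr mxtraceD mxtraceZ hx hy mulr0 addr0.
  - by move=> _ /mapP [S _ ->].
have [v Xv0] : exists v : 'cV[R]_d, X *m v != 0.
  apply: contrapT => h; move: X0; apply/negP/negPn/eqP.
  apply/matrixP => i j; rewrite mxE.
  have /eqP : X *m delta_mx j ord0 = 0 :> 'cV[R]_d.
    by apply/eqP/negPn/negP => ?; apply: h; exists (delta_mx j ord0).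
  by rewrite -colE => /eqP/matrixP/(_ i ord0); rewrite !mxE.
have [ss' spv] := irreducible_span Xv0.
have : v \in <<[seq W s *m (X *m v) | s <- ss']>>%VS by rewrite spv memvf.
have lift : forall u, u \in <<[seq W s *m (X *m v) | s <- ss']>>%VS ->
    exists2 Y, Y \in V & u = Y *m (X *m v).
  apply: span_closed.
  - by exists 0; rewrite ?mem0v // mul0mx.
  - move=> a x y [Y1 h1 ->] [Y2 h2 ->]; exists (a *: Y1 + Y2).
      by rewrite rpredD // rpredZ.
    by rewrite mulmxDl scalemxAl.
  - by move=> _ /mapP [S _ ->]; exists (W S).
move=> /lift [Y YV vE]; set Z : 'M[R]_d := Y *m X.
have trZ k : \tr (Z ^+ k.+1) = 0.
  rewrite exprSr -mulmxE /Z mulmxA mxtrace_mulC; apply: trV.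
  apply: (mulV) => //; elim: k => [|k IH].
    by rewrite expr0 -[1]/(1%:M) -word_prod_nil.
  by rewrite exprS -mulmxE; apply: (mulV) => //; exact: mulV.
have [t [_ _ trt dett]] := spectrum_enumeration Z.
have v0 : v != 0 by apply: contraNneq Xv0 => ->; rewrite mulmx0.
have det0 : \det (1 - Z) = 0.
  apply/eqP; have : \det (1 - Z) *: v = 0.
    rewrite -mul_scalar_mx -mul_adj_mx -mulmxA mulmxBl mul1mx /Z -mulmxA -vE.
    by rewrite subrr mulmx0.
  by move/eqP; rewrite scaler_eq0 (negPf v0) orbF.
move: dett; rewrite det0 => /esym/eqP/prodf_eq0 [i _].
rewrite subr_eq0 eq_sym; apply/negP; apply: power_sums_eq0 => [|k].
  exact: pchar_num.
by rewrite -trt trZ.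
Qed.

Lemma linear_bounded n p q (f : {linear 'rV[R]_n -> 'M[R]_(p, q)}) :
  exists2 c, 0 <= c & forall y, `|f y| <= c * `|y|.
Proof.
exists (\sum_i `|f (delta_mx ord0 i)|) => [|y]; first exact: sumr_ge0.
rewrite {1}(row_sum_delta y) linear_sum (le_trans (ler_norm_sum _ _ _)) //.
rewrite mulr_suml; apply: ler_sum => i _.
by rewrite linearZ normrZ mulrC ler_wpM2l // mx_entry_le.
Qed.

(* The trace form is nondegenerate on the algebra spanned by the products, so a
   product is a fixed linear function of finitely many traces of products. *)
Lemma bounded_products c : (forall S, `|\tr (W S)| <= c) ->
  exists2 C, 0 < C & forall S, `|W S| <= C.
Proof.
move=> trc; have [ss sp] := finite_spanning W.
set V := <<map W ss>>%VS in sp.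
pose n := size ss.
pose phi (X : 'M[R]_d) : 'rV[R]_n := \row_(k < n) \tr (X *m W (nth [::] ss k)).
have phi_lin : linear phi.
  by move=> a x y; apply/rowP => k; rewrite !mxE mulmxDl -scalemxAl mxtraceD mxtraceZ.
pose phiL : {linear 'M[R]_d -> 'rV[R]_n} :=
  HB.pack phi (GRing.isLinear.Build _ _ _ _ phi phi_lin).
(* Nondegeneracy says that [f] is injective; its left inverse recovers a product from its traces. *)
pose f : 'Hom(subvs_of V, 'rV[R]_n) := linfun (phiL \o vsval).
have kf : lker f == 0%VS.
  apply/lker0P => x y; rewrite !lfunE /= => exy.
  apply/val_inj/eqP; rewrite -subr_eq0; apply/eqP => /=.
  apply: (@trace_form_nondegenerate ss) => //.
    by rewrite rpredB ?subvsP.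
  move=> S; have : W S \in V by [].
  move: (W S) => Y; move: Y; apply: span_closed.
  - by rewrite mulmx0 mxtrace0.
  - by move=> a u v hu hv; rewrite mulmxDr -scalemxAr mxtraceD mxtraceZ hu hv mulr0 addr0.
  - move=> _ /mapP [T /(nthP [::]) [k kn <-] ->].
    have /rowP/(_ (Ordinal kn)) := exy; rewrite !mxE /= => e.
    by rewrite mulmxBl mxtraceD [\tr (- _)]raddfN /= e subrr.
have [c' c'0 hc'] := linear_bounded (vsval \o (f^-1)%VF).
have c0 : 0 <= c by apply: le_trans (trc [::]).
exists (c' * c + 1) => [|S]; first by rewrite ltr_wpDl // mulr_ge0.
have e : W S = vsval ((f^-1)%VF (phi (W S))).
  have := lker0_lfunK kf (vsproj V (W S)).
  by rewrite lfunE /= vsprojK // => ->; rewrite vsprojK.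
rewrite e (le_trans (hc' (phi (W S)))) // ler_wpDr // ler_wpM2l //.
by apply: mx_norm_le => // i j; rewrite mxE -word_prod_cat.
Qed.

End TraceForm.

(** * The projection onto the leading plane *)

Section RationalArgument.
Variable R : realType.

Lemma complex_polar_exp (r phi : R) n :
  ((r * cos phi +i* (r * sin phi)) ^+ n =
   (r ^+ n * cos (phi *+ n)) +i* (r ^+ n * sin (phi *+ n)))%C.
Proof.
elim: n => [|n IH]; first by rewrite !expr0 mulr0n cos0 sin0 mulr0 mulr1.
rewrite [LHS]exprS IH mulrS cosD sinD; apply/eqP; rewrite eq_complex /= exprS.
by apply/andP; split; apply/eqP; ring.
Qed.

Lemma sin_pi_int (p : int) : sin (pi *~ p) = 0 :> R.
Proof.
have sinn n : sin (pi *+ n) = 0 :> R.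
  by elim: n => [|n IH]; rewrite ?mulr0n ?sin0 // mulrSr sinDpi IH oppr0.
by case: p => n; rewrite ?NegzE ?mulrNz ?sinN -?pmulrn sinn ?oppr0.
Qed.

(** Raising to the denominator makes the argument a multiple of [pi], hence the value real; squaring
    removes the sign. *)
Lemma rational_arg_power (l : R[i]) : rational_mod_pi_arg l ->
  exists2 N, (0 < N)%N & l ^+ N = (Normc.normc l ^+ N)%:C%C.
Proof.
move=> [phi [lE [r phir]]]; set n := Normc.normc l in lE *.
exists (`|denq r| * 2)%N; first by rewrite muln_gt0 absz_gt0 denq_neq0.
have phiq : phi *+ `|denq r|%N = pi *~ numq r.
  have -> : phi = ratr r * pi by rewrite -phir divfK // gt_eqF // pi_gt0.
  rewrite -[_ *+ _]mulr_natr mulrAC -[in RHS]mulrzl; congr (_ * _).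
  have q0 : (denq r)%:~R != 0 :> R by rewrite intr_eq0 denq_neq0.
  rewrite /ratr pmulrn gez0_abs ?ltW ?denq_gt0 // divfK //.
rewrite !exprM lE complex_polar_exp phiq sin_pi_int mulr0.
have c2 : cos (pi *~ numq r) ^+ 2 = 1 :> R.
  by rewrite -(cos2Dsin2 (pi *~ numq r)) sin_pi_int expr0n addr0.
by rewrite complexr0 -rmorphXn /= exprMn c2 mulr1.
Qed.

End RationalArgument.

Section Decay.
Variable R : realType.

Lemma contracting_recurrence_cvg0 (a e : R^nat) (theta : R) :
  0 <= theta -> theta < 1 -> (forall k, 0 <= a k) ->
  (forall k, a k.+1 <= theta * a k + e k) -> e @ \oo --> 0 ->
  a @ \oo --> 0.
Proof.
move=> t0 t1 a0 ha ce; apply/cvgrPdist_le => eps eps0.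
(* With [e] replaced by this bound, [eps / 2] is the fixed point of the recurrence. *)
have d0 : 0 < eps / 2 * (1 - theta) by rewrite mulr_gt0 ?divr_gt0 ?subr_gt0.
have /cvgrPdist_le /(_ _ d0) [k0 _ hk0] := ce.
have bnd n : a (n + k0)%N <= a k0 * theta ^+ n + eps / 2.
  elim: n => [|n IH]; first by rewrite add0n expr0 mulr1 lerDl divr_ge0 ?ltW.
  have := hk0 (n + k0)%N (leq_addl _ _); rewrite /= sub0r normrN => /ler_normlP [_ h].
  apply: le_trans (ha _) _; rewrite exprS.
  have := ler_wpM2l t0 IH; nra.
have tt : `|theta| < 1 by rewrite ger0_norm.
have e20 : 0 < eps / 2 by rewrite divr_gt0.
have /cvgrPdist_le /(_ _ e20) [k1 _ hk1] := cvg_geometric (a k0) tt.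
exists (k1 + k0)%N => // k /= kk.
have := hk1 (k - k0)%N; rewrite /= sub0r normrN => /(_ _) /ler_normlP [|_ h].
  by lia.
rewrite sub0r normrN ger0_norm //.
have := bnd (k - k0)%N; rewrite subnK ?(leq_trans (leq_addl _ _) kk) //.
by move=> h2; apply: (le_trans h2); rewrite [X in _ <= X](splitr eps) lerD2r.
Qed.

(** This replaces a Jordan form. [M ^+ k.+1 *m u] is [z] times [M ^+ k *m u] plus [M ^+ k] applied
    to a matrix killed by the remaining factors, so the scaled moduli satisfy a recurrence of ratio
    [Normc.normc z / r] with a perturbation that decays by induction. *)
Lemma power_decay d p (M : 'M[R[i]]_d.+1) r (rs : seq R[i]) (u : 'M[R[i]]_(d.+1, p)) :
  0 < r -> (forall z, z \in rs -> Normc.normc z < r) ->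
  horner_mx M (\prod_(z <- rs) ('X - z%:P)) *m u = 0 ->
  forall i j, (fun k => r ^- k * Normc.normc ((M ^+ k *m u) i j)) @ \oo --> 0.
Proof.
move=> r0; elim: rs u => [|z rs IH] u hz.
  rewrite big_nil rmorph1 mul1mx => -> i j.
  under eq_fun do rewrite mulmx0 mxE Normc.normc0 mulr0.
  exact: cvg_cst.
rewrite big_cons mulrC rmorphM /= -mulmxE -mulmxA => hu i j.
have zr : Normc.normc z / r < 1 by rewrite ltr_pdivrMr // mul1r hz // mem_head.
apply: (contracting_recurrence_cvg0 (theta := Normc.normc z / r)
  (e := fun k => r^-1 * (r ^- k *
    Normc.normc ((M ^+ k *m (horner_mx M ('X - z%:P) *m u)) i j)))) => //.
- by rewrite divr_ge0 ?normc_ge0 // ltW.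
- by move=> k; rewrite mulr_ge0 ?normc_ge0 // invr_ge0 exprn_ge0 // ltW.
- move=> k; have -> : M ^+ k.+1 *m u =
      z *: (M ^+ k *m u) + M ^+ k *m (horner_mx M ('X - z%:P) *m u).
    rewrite rmorphB /= horner_mx_X horner_mx_C mulmxBl mulmxBr mul_scalar_mx.
    by rewrite -scalemxAr addrC subrK mulmxA mulmxE -exprSr.
  have -> : Normc.normc z / r * (r ^- k * Normc.normc ((M ^+ k *m u) i j)) +
     r^-1 * (r ^- k * Normc.normc ((M ^+ k *m (horner_mx M ('X - z%:P) *m u)) i j))
     = r ^- k.+1 * (Normc.normc z * Normc.normc ((M ^+ k *m u) i j) +
       Normc.normc ((M ^+ k *m (horner_mx M ('X - z%:P) *m u)) i j)).
    by rewrite exprS invfM; ring.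
  rewrite ler_wpM2l ?invr_ge0 ?exprn_ge0 ?(ltW r0) //.
  move: (M ^+ k *m u) (M ^+ k *m _) => X Y.
  by rewrite !mxE -Normc.normcM; exact: le_normcD.
- rewrite -(mulr0 r^-1); apply: cvgM; first exact: cvg_cst.
  by apply: IH => // z' z'rs; apply: hz; rewrite inE z'rs orbT.
Qed.

End Decay.

Section SpectralProjection.
Variables (R : realType) (d' : nat).
Local Notation d := d'.+1.
Local Notation toC := (real_complex R).

Lemma horner_mx_eigenvector (F : fieldType) (M : 'M[F]_d) (v : 'cV[F]_d) l
    (p : {poly F}) :
  M *m v = l *: v -> horner_mx M p *m v = p.[l] *: v.
Proof.
move=> Mv; elim/poly_ind: p => [|p c IH].
  by rewrite rmorph0 mul0mx horner0 scale0r.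
rewrite rmorphD rmorphM /= horner_mx_X horner_mx_C mulmxDl -mulmxE -mulmxA Mv.
by rewrite -scalemxAr IH mul_scalar_mx hornerMXaddC scalerA mulrC scalerDl.
Qed.

(** [eigenvalue] refers to row vectors; the transpose has the same characteristic polynomial. *)
Lemma eigenvector_column (F : fieldType) (M : 'M[F]_d) l : eigenvalue M l ->
  exists2 v : 'cV[F]_d, v != 0 & M *m v = l *: v.
Proof.
have char_tr : char_poly M^T = char_poly M.
  rewrite /char_poly -[RHS]det_tr; congr (\det _).
  by apply/matrixP => i j; rewrite !mxE eq_sym.
rewrite eigenvalue_root_char -char_tr -eigenvalue_root_char.
move=> /eigenvalueP [v vM v0]; exists v^T; first by rewrite trmx_eq0.
by apply: trmx_inj; rewrite trmx_mul trmxK vM linearZ /= trmxK.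
Qed.

Lemma conj_root_real_poly (p : {poly R}) (l : R[i]) :
  root (map_poly toC p) l^*%C = root (map_poly toC p) l.
Proof.
rewrite -[in RHS](conjcK l) -[RHS]complex_root_conj.
have {1}-> : map_poly toC p = map_poly conjc (map_poly toC p).
  by apply/polyP => i; rewrite !coef_map /= oppr0.
by rewrite complex_root_conj conjcK.
Qed.

(** The factors are real so that the projection built from them is real. A root of [g] at [l] would
    make [l] a double root; the conjugate follows because [g] is real. *)
Lemma spectral_splitting (M : 'M[R]_d) (l : R[i]) :
  unique_simple_leading M l -> complex.Im l != 0 ->
  exists f g : {poly R},
  [/\ char_poly M = g * f, coprimep f g,
      map_poly toC f = ('X - l%:P) * ('X - (l^*%C)%:P) &
      forall z, root (map_poly toC g) z -> Normc.normc z < Normc.normc l].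
Proof.
move=> [[el _] mupl lead] Iml.
have chiC : map_poly toC (char_poly M) = char_poly (complexify M).
  exact: map_char_poly.
pose f : {poly R} := 'X^2 - (2 * complex.Re l)%:P * 'X
   + (complex.Re l ^+ 2 + complex.Im l ^+ 2)%:P.
have fC : map_poly toC f = ('X - l%:P) * ('X - (l^*%C)%:P).
  rewrite /f rmorphD rmorphB /= map_polyXn rmorphM /= map_polyX !map_polyC /=.
  have -> : ((2 * complex.Re l)%:C)%C = l + l^*%C.
    by case: l {el mupl lead Iml f} => a b /=; apply/eqP; rewrite eq_complex /= subrr eqxx mulr_natl mulr2n eqxx.
  have -> : ((complex.Re l ^+ 2 + complex.Im l ^+ 2)%:C)%C = l * l^*%C.
    case: l {el mupl lead Iml f} => a b /=; apply/eqP; rewrite eq_complex /=.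
    by apply/andP; split; apply/eqP; ring.
  rewrite polyCD polyCM; ring.
have nll : l != l^*%C.
  case: l Iml {el mupl lead f fC} => a b /= b0; rewrite eq_complex /= eqxx /=.
  by rewrite -subr_eq0 opprK -mulr2n mulrn_eq0.
have rl : root (map_poly toC (char_poly M)) l by rewrite chiC -eigenvalue_root_char.
have fchi : f %| char_poly M.
  rewrite -(dvdp_map toC) fC Gauss_dvdp.
    by rewrite !dvdp_XsubCl conj_root_real_poly rl.
  by rewrite coprimep_XsubC root_XsubC eq_sym.
pose g := char_poly M %/ f.
have chiE : char_poly M = g * f by rewrite /g divpK.
have gl : ~~ root (map_poly toC g) l.
  apply/negP; rewrite -dvdp_XsubCl => gl.
  have chi0 : char_poly (complexify M) != 0.
    by rewrite monic_neq0 // char_poly_monic.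
  have : (2 <= mup l (char_poly (complexify M)))%N.
    rewrite mup_geq // -chiC chiE rmorphM /= fC expr2 mulrA.
    by rewrite dvdp_mulr // dvdp_mul.
  by rewrite mupl.
have gl' : ~~ root (map_poly toC g) l^*%C by rewrite conj_root_real_poly.
exists f, g; split=> //.
  rewrite -(coprimep_map toC) fC coprimep_sym coprimepMr.
  by rewrite !coprimep_XsubC gl gl'.
move=> z gz; apply: lead.
- by rewrite eigenvalue_root_char -chiC chiE rmorphM rootM gz.
- by apply: contraNneq gl => <-.
- by apply: contraNneq gl' => <-.
Qed.

(** [P] is [v * g] evaluated at [M], where [u * f + v * g = 1]. On its range [M] is annihilated by
    [f], hence by ['X^N - (r ^+ N)%:P]; on the range of [1%:M - P] it is annihilated by [g], whose
    roots have modulus below [r]. Real and imaginary parts of an eigenvector give [v1] and [v2]. *)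
Lemma spectral_projection (M : 'M[R]_d) (l : R[i]) N :
  unique_simple_leading M l -> complex.Im l != 0 ->
  l ^+ N = (Normc.normc l ^+ N)%:C%C ->
  exists P : 'M[R]_d,
  [/\ P *m P = P, M *m P = P *m M,
      M ^+ N *m P = Normc.normc l ^+ N *: P,
      mx_cvg (fun k => Normc.normc l ^- k *: (M ^+ k *m (1%:M - P))) 0 &
      exists v1 v2 : 'cV[R]_d, [/\ P *m v1 = v1, P *m v2 = v2 &
        forall a b, a *: v1 + b *: v2 = 0 -> a = 0 /\ b = 0]].
Proof.
move=> usl Iml lN; set r := Normc.normc l in lN *.
have [f [g [chiE cfg fC gz]]] := spectral_splitting usl Iml.
have [[el _] _ _] := usl.
have l0 : l != 0 by apply: contraNneq Iml => ->.
have r0 : 0 < r.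
  rewrite lt_neqAle normc_ge0 andbT eq_sym; apply: contraNneq l0.
  by move/Normc.eq0_normc => ->.
have /Bezout_eq1_coprimepP [[u v] /= uv1] := cfg.
pose P := horner_mx M (v * g).
have P1 : 1%:M - P = horner_mx M (u * f).
  by rewrite /P -[1%:M](rmorph1 (horner_mx M)) -uv1 rmorphD /= addrK.
have CH : horner_mx M (g * f) = 0 by rewrite -chiE Cayley_Hamilton.
have PMP : P *m P = P.
  apply/eqP; rewrite -subr_eq0 -[X in _ - X]mulmx1 -mulmxBr -oppr_eq0 -mulmxN opprB.
  rewrite P1 /P mulmxE -rmorphM /= mulrACA.
  by rewrite rmorphM /= CH mulr0.
have comMP : M *m P = P *m M.
  exact: (comm_mx_horner (v * g) (erefl (M *m M))).
exists P; split => //.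
- have fN : f %| 'X^N - (r ^+ N)%:P.
    rewrite -(dvdp_map toC) fC rmorphB /= map_polyXn map_polyC /=.
    have rt z : z ^+ N = (r ^+ N)%:C%C -> root ('X^N - ((r ^+ N)%:C%C)%:P) z.
      by move=> zN; rewrite /root !hornerE zN subrr.
    rewrite Gauss_dvdp.
      by rewrite !dvdp_XsubCl !rt // -rmorphXn /= lN conjc_real.
    rewrite coprimep_XsubC root_XsubC; move: Iml; case: (l) => a b /= b0.
    by rewrite eq_complex /= eqxx /= -subr_eq0 -opprD oppr_eq0 -mulr2n mulrn_eq0.
  apply/eqP; rewrite -subr_eq0 -mul_scalar_mx -mulmxBl -(horner_mx_C M).
  have -> : M ^+ N = horner_mx M 'X^N by rewrite rmorphXn /= horner_mx_X.
  rewrite -rmorphB /= -(divpK fN) /P mulmxE -rmorphM /=.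
  by rewrite mulrACA (mulrC f) rmorphM /= CH mulr0.
- have [rs gE] := closed_field_poly_normal (map_poly toC g).
  have g0 : map_poly toC g != 0.
    rewrite map_poly_eq0; apply: contraTneq (char_poly_monic M) => g0.
    by rewrite chiE g0 mul0r monicE lead_coef0 eq_sym oner_eq0.
  have hrs z : z \in rs -> Normc.normc z < r.
    move=> zrs; apply: gz; rewrite gE rootZ ?lead_coef_eq0 //.
    by rewrite root_prod_XsubC.
  have dec : horner_mx (complexify M) (\prod_(z <- rs) ('X - z%:P)) *m
      complexify (1%:M - P) = 0.
    apply: (scalerI (a := lead_coef (map_poly toC g))).
      by rewrite lead_coef_eq0.
    rewrite scaler0 scalemxAl -horner_mxZ -gE /complexify -map_horner_mx P1.
    rewrite -map_mxM mulmxE -rmorphM /= mulrCA.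
    by rewrite rmorphM /= CH mulr0 map_mx0.
  move=> i j; rewrite mxE; apply/cvgrPdist_le => e e0.
  have /cvgrPdist_le /(_ _ e0) [k0 _ hk0] := power_decay r0 hrs dec i j.
  exists k0 => // k /hk0 /=; rewrite !sub0r !normrN; congr (_ <= _).
  have -> : complexify M ^+ k *m complexify (1%:M - P) =
      complexify (M ^+ k *m (1%:M - P)).
    by rewrite /complexify map_mxM rmorphXn.
  by rewrite [in LHS]mxE [in RHS]mxE /= expr0n addr0 sqrtr_sqr !normrM normr_id.
- have [w w0 Mw] := eigenvector_column el.
  have Pw : complexify P *m w = w.
    apply/eqP; rewrite eq_sym -subr_eq0 -{1}[w]mul1mx -mulmxBl.
    have -> : 1%:M - complexify P = complexify (1%:M - P).
      by rewrite /complexify map_mxB map_mx1.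
    rewrite P1 /complexify map_horner_mx (horner_mx_eigenvector _ Mw).
    by rewrite rmorphM /= fC !hornerM hornerXsubC subrr mul0r mulr0 scale0r.
  pose v1 : 'cV[R]_d := \col_i complex.Re (w i ord0).
  pose v2 : 'cV[R]_d := \col_i complex.Im (w i ord0).
  have actE (X : 'M[R]_d) i : (complexify X *m w) i ord0 =
      ((X *m v1) i ord0 +i* (X *m v2) i ord0)%C.
    rewrite !mxE; elim/big_rec3: _ => // k x y z _ ->.
    rewrite !mxE; case: (w k ord0) => a b /=; apply/eqP; rewrite eq_complex /=.
    by rewrite !mul0r subr0 addr0 !eqxx.
  have col0 (x : 'cV[R]_d) (j : 'I_1) i : x i j = x i ord0 by rewrite (ord1 j).
  exists v1, v2; split.
  + apply/matrixP => i j; rewrite !col0; have := actE P i; rewrite Pw => e.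
    by rewrite [RHS]mxE e.
  + apply/matrixP => i j; rewrite !col0; have := actE P i; rewrite Pw => e.
    by rewrite [RHS]mxE e.
  (* Applying [M] to the relation gives a second equation for each entry of the eigenvector. As [l]
     is not real, the two reduce to a linear system of determinant [a ^+ 2 + b ^+ 2] up to sign. *)
  move=> a b ab0; apply: contrapT => nab.
  have s0 : a ^+ 2 + b ^+ 2 != 0.
    apply: contra_notN nab; rewrite paddr_eq0 ?sqr_ge0 // !sqrf_eq0.
    by move=> /andP[/eqP-> /eqP->].
  have ent i : a * v1 i ord0 + b * v2 i ord0 = 0.
    by move/matrixP/(_ i ord0): ab0; rewrite !mxE.
  have ent2 i : a * (M *m v1) i ord0 + b * (M *m v2) i ord0 = 0.
    have /matrixP/(_ i ord0) : M *m (a *: v1 + b *: v2) = 0 by rewrite ab0 mulmx0.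
    by rewrite mulmxDr -!scalemxAr !mxE.
  case/eqP: w0; apply/matrixP => i j; rewrite (ord1 j) mxE.
  have := actE M i; rewrite Mw.
  have := ent i; have := ent2 i.
  move: ((M *m v1) i ord0) ((M *m v2) i ord0) => m1 m2; rewrite !mxE.
  case: (w i ord0) => x y; case: (l) Iml => al be /= be0 e1 e2 [? ?]; subst m1 m2.
  have e3 : b * x - a * y = 0.
    apply: (mulfI be0); have -> : be * (b * x - a * y) =
      (a * (al * x - be * y) + b * (al * y + be * x)) - al * (a * x + b * y) by ring.
    by rewrite e1 e2 !mulr0 subrr.
  have x0 : x = 0.
    apply: (mulfI s0); have -> : (a ^+ 2 + b ^+ 2) * x =
      a * (a * x + b * y) + b * (b * x - a * y) by ring.
    by rewrite e2 e3 !mulr0 addr0.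
  have y0 : y = 0.
    apply: (mulfI s0); have -> : (a ^+ 2 + b ^+ 2) * y =
      b * (a * x + b * y) - a * (b * x - a * y) by ring.
    by rewrite e2 e3 !mulr0 subrr.
  by rewrite x0 y0.
Qed.

End SpectralProjection.

(** * Convex hulls of finite sets *)

Section ConvexHull.
Variables (R : realType) (n : nat).
Local Notation V := 'cV[R]_n.
Implicit Types (G H : set V) (s : seq V).

Lemma convex_setP G : @convex_set R V G <->
  forall x y t, 0 <= t -> t <= 1 -> G x -> G y -> G (t *: x + (1 - t) *: y).
Proof.
split=> [cG x y t t0 t1 /mem_set Gx /mem_set Gy|cG x y t /set_mem Gx /set_mem Gy].
  by have /set_mem := cG x y (Itv01 t0 t1) Gx Gy.
by apply/mem_set; apply: cG.
Qed.

Lemma sub_convex_hull G : G `<=` convex_hull G.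
Proof. exact: sub_smallest. Qed.

Lemma convex_hull_convex G : @convex_set R V (convex_hull G).
Proof.
apply/convex_setP => x y t t0 t1 hx hy C [cC GC].
by move/convex_setP: (cC); apply => //; [apply: hx|apply: hy].
Qed.

Lemma convex_hull_min G H : @convex_set R V H -> G `<=` H -> convex_hull G `<=` H.
Proof. by move=> cH GH; apply: smallest_sub. Qed.

Lemma convex_hull_mono G H : G `<=` H -> convex_hull G `<=` convex_hull H.
Proof.
by move=> GH; apply: convex_hull_min (@convex_hull_convex H) _ => x /GH; exact: sub_convex_hull.
Qed.

Lemma convex_preimage m (L : 'M[R]_(m, n)) (H : set 'cV[R]_m) :
  @convex_set R 'cV[R]_m H -> @convex_set R V [set x | H (L *m x)].
Proof.
move=> cH; apply/convex_setP => x y t t0 t1 /= hx hy.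
rewrite mulmxDr -!scalemxAr; move: hx hy.
move: (L *m x) (L *m y) => x' y' hx hy.
have /set_mem := cH x' y' (Itv01 t0 t1) (mem_set hx) (mem_set hy).
exact.
Qed.

Lemma dilate1 G : dilate 1 G = G.
Proof.
by apply/seteqP; split=> [_ [y Gy <-]|x Gx]; [rewrite scale1r|exists x; rewrite ?scale1r].
Qed.

Lemma dilate_dilate a b G : dilate a (dilate b G) = dilate (a * b) G.
Proof.
apply/seteqP; split=> [_ [_ [y Gy <-] <-]|_ [y Gy <-]].
  by exists y; rewrite ?scalerA.
by exists (b *: y); [exists y|rewrite scalerA].
Qed.

Lemma dilate_sub c G H : G `<=` H -> dilate c G `<=` dilate c H.
Proof. by move=> GH _ [y /GH Hy <-]; exists y. Qed.

Lemma convex_dilate c G : @convex_set R V G -> @convex_set R V (dilate c G).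
Proof.
move=> /convex_setP cG; apply/convex_setP => _ _ t t0 t1 [x Gx <-] [y Gy <-].
exists (t *: x + (1 - t) *: y); first exact: cG.
by rewrite scalerDr !scalerA (mulrC c t) (mulrC c (1 - t)).
Qed.

Lemma dilateD a b G x y : @convex_set R V G -> 0 <= a -> 0 <= b ->
  dilate a G x -> dilate b G y -> dilate (a + b) G (x + y).
Proof.
move=> /convex_setP cG a0 b0 [x' Gx <-] [y' Gy <-].
have [ab0|ab] := eqVneq (a + b) 0.
  move/eqP: ab0; rewrite paddr_eq0 // => /andP[/eqP-> /eqP->].
  by exists x' => //; rewrite !addr0 !scale0r addr0.
have abp : 0 < a + b by rewrite lt_neqAle eq_sym ab addr_ge0.
exists (a / (a + b) *: x' + (1 - a / (a + b)) *: y').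
  apply: cG => //; first by rewrite divr_ge0 // ltW.
  by rewrite ler_pdivrMr // mul1r lerDl.
rewrite scalerDr !scalerA mulrBr mulr1 mulrC divfK //.
by congr (_ + _ *: _); ring.
Qed.

Lemma dilate_le a b G : @convex_set R V G -> G 0 -> 0 <= a -> a <= b ->
  dilate a G `<=` dilate b G.
Proof.
move=> cG G0 a0 ab x Gx; rewrite -(addr0 x) -(subrK a b) addrC.
apply: dilateD => //; first by rewrite subr_ge0.
by exists 0 => //; rewrite scaler0.
Qed.

(** Membership in a dilated hull is shown below by splitting the vector and adding dilation factors,
    without explicit convex coefficients. *)
Lemma dilate_sum (I : Type) (r : seq I) (c : I -> R) (f : I -> V) G :
  @convex_set R V G -> G !=set0 -> (forall i, 0 <= c i) ->
  (forall i, dilate (c i) G (f i)) ->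
  dilate (\sum_(i <- r) c i) G (\sum_(i <- r) f i).
Proof.
move=> cG [x0 Gx0] c0 hf.
have : 0 <= \sum_(i <- r) c i /\ dilate (\sum_(i <- r) c i) G (\sum_(i <- r) f i).
  elim/big_ind2: _ => [|c1 f1 c2 f2 [h1 h2] [h3 h4]|i _] //.
    by split=> //; exists x0; rewrite ?scale0r.
  by split; [exact: addr_ge0|exact: dilateD].
by case.
Qed.

Definition hull_seq s : set V := convex_hull [set x | x \in s].

Lemma mem_hull_seq s x : x \in s -> hull_seq s x.
Proof. by move=> xs; apply: sub_convex_hull. Qed.

Lemma hull_seq_min s H : @convex_set R V H -> (forall x, x \in s -> H x) ->
  hull_seq s `<=` H.
Proof. by move=> cH sH; apply: convex_hull_min. Qed.

Lemma hull_seq_mulmx s H (L : 'M[R]_n) : @convex_set R V H ->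
  (forall x, x \in s -> H (L *m x)) -> forall x, hull_seq s x -> H (L *m x).
Proof.
by move=> cH h; apply: (hull_seq_min (H := [set x | H (L *m x)])) => //; exact: convex_preimage.
Qed.

Lemma hull_seqN s : (forall x, x \in s -> - x \in s) ->
  forall x, hull_seq s x -> hull_seq s (- x).
Proof.
move=> sN x hx.
have -> : - x = (- 1%:M) *m x by rewrite mulNmx mul1mx.
apply: (hull_seq_mulmx (@convex_hull_convex _) _ hx) => y ys.
by rewrite mulNmx mul1mx; apply: mem_hull_seq; exact: sN.
Qed.

Lemma hull_seq0 s x0 : (forall x, x \in s -> - x \in s) -> x0 \in s -> hull_seq s 0.
Proof.
move=> sN x0s; have /convex_setP cs := @convex_hull_convex [set x | x \in s].
have -> : 0 = 2^-1 *: x0 + (1 - 2^-1) *: - x0.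
  by rewrite scalerN -scalerBl (_ : _ - _ = 0) ?scale0r //; lra.
apply: cs; rewrite ?invr_ge0 ?invf_le1 ?ler1n //.
  exact: sub_convex_hull.
by apply: sub_convex_hull; exact: sN.
Qed.

(** The hull is the image of the standard simplex, a closed subset of a cube, under a continuous
    map. *)
Lemma hull_seq_compact s : compact (hull_seq s).
Proof.
pose k := size s.
pose T := [set t : 'rV[R]_k | forall i, `[0, 1]%classic (t ord0 i)] `&`
          [set t : 'rV[R]_k | \sum_i t ord0 i = 1].
pose f (t : 'rV[R]_k) : V := \sum_(i < k) t ord0 i *: nth 0 s i.
have cT : compact T.
  apply: compact_closedI.
    have := @rV_compact R k (fun=> `[(0 : R), 1]%classic) (fun=> @segment_compact R 0 1).
    exact.
  have : closed ((fun t : 'rV[R]_k => \sum_i t ord0 i) @^-1` [set 1]).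
    apply: closed_comp; last exact: closed_eq.
    move=> t _; apply: continuous_big => [|i _]; first exact: add_continuous.
    exact: coord_continuous.
  exact.
have cf : continuous f.
  apply: continuous_big => [|i _ t]; first exact: add_continuous.
  apply: (@cvgZr_tmp _ _ _ (nbhs t)); exact: (@coord_continuous _ _ _ ord0 i t).
suff -> : hull_seq s = f @` T.
  by apply: continuous_compact => //; exact: continuous_subspaceT.
apply/seteqP; split.
  apply: hull_seq_min.
    apply/convex_setP => _ _ a a0 a1 [t [t01 ts] <-] [u [u01 us] <-].
    exists (a *: t + (1 - a) *: u).
      split=> /= [i|].
        have := t01 i; have := u01 i; rewrite /= !in_itv /= !mxE.
        by move=> /andP[? ?] /andP[? ?]; apply/andP; split; nra.
      under eq_bigr do rewrite !mxE.
      by rewrite big_split /= -!mulr_sumr ts us; ring.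
    rewrite /f !scaler_sumr -big_split /=; apply: eq_bigr => i _.
    by rewrite !mxE !scalerA scalerDl.
  move=> x xs; have ik : (index x s < k)%N by rewrite index_mem.
  exists (delta_mx ord0 (Ordinal ik)).
    split=> [i|] /=.
      by rewrite in_itv /= mxE ler0n lern1 leq_b1.
    rewrite (bigD1 (Ordinal ik)) //= big1 ?addr0 ?mxE ?eqxx //.
    by move=> i ne; rewrite mxE (negPf ne) andbF.
  rewrite /f (bigD1 (Ordinal ik)) //= big1 ?addr0.
    by rewrite mxE !eqxx scale1r nth_index.
  by move=> i ne; rewrite mxE (negPf ne) andbF scale0r.
move=> _ [t [t01 /= ts] <-].
rewrite -[hull_seq s]dilate1 -ts.
apply: dilate_sum; first exact: convex_hull_convex.
- case: (posnP k) => [k0|k0].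
    move: ts; rewrite big1 => [/esym/eqP|i _]; first by rewrite oner_eq0.
    by exfalso; case: (i) => j /=; rewrite k0.
  by exists (nth 0 s 0); apply: mem_hull_seq; exact: mem_nth.
- by move=> i; have := t01 i; rewrite /= in_itv /= => /andP[].
- by move=> i; exists (nth 0 s i) => //; apply: mem_hull_seq; exact: mem_nth.
Qed.

End ConvexHull.

(** * Contraction outside the powers of the dominant word *)

Lemma net_pigeonhole (R : realType) m n (s : seq 'M[R]_(m, n)) (f : nat -> 'M[R]_(m, n))
    (e : R) k : (size s < k)%N ->
  (forall i, (i < k)%N -> exists2 Y, Y \in s & `|f i - Y| <= e) ->
  exists i j, [/\ (i < j)%N, (j < k)%N & `|f i - f j| <= e + e].
Proof.
move=> sk hf.
pose h (i : 'I_k) := sval (cid2 (hf i (ltn_ord i))).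
have hP i : h i \in s /\ `|f i - h i| <= e.
  by rewrite /h; case: cid2.
pose g (i : 'I_k) : 'I_(size s) :=
  Ordinal (introT idP (etrans (index_mem (h i) s) (hP i).1)).
have /injectivePn [i [j ij gij]] : ~~ injectiveb g.
  apply: contraL sk => /injectiveP /leq_card.
  by rewrite !card_ord -leqNgt.
have hij : h i = h j.
  have := congr1 val gij => /= e1.
  by rewrite -(nth_index 0 (hP i).1) e1 nth_index // (hP j).1.
have dist : `|f i - f j| <= e + e.
  rewrite -[f i - f j](subrKA (h i)) (le_trans (ler_normD _ _)) // lerD ?(hP i).2 //.
  by rewrite hij distrC (hP j).2.
move: ij; rewrite neq_ltn => /orP[] ij.
  by exists i, j; split.
by exists j, i; split => //; rewrite distrC.
Qed.

(* The family divided by [nu A w]: [P] projects onto the leading plane of the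
   product of [w], and [ds_det_ge] is the form of the spectral gap that passes to
   limits of products. *)
Record dominated_system (R : realType) (d' m : nat) (B : 'I_m -> 'M[R]_d'.+1)
    (w : seq 'I_m) (P : 'M[R]_d'.+1) (N : nat) (C eta : R) : Prop := {
  ds_irreducible : irreducible_family B;
  ds_neq_nil : w <> [::];
  ds_primitive : primitive w;
  ds_N_gt0 : (0 < N)%N;
  ds_proj : P *m P = P;
  ds_comm : word_prod B w *m P = P *m word_prod B w;
  ds_period : word_prod B w ^+ N *m P = P;
  ds_limit : mx_cvg (fun k => word_prod B w ^+ (N * k)) P;
  ds_C_gt0 : 0 < C;
  ds_norm_le : forall S, `|word_prod B S| <= C;
  ds_eta_gt0 : 0 < eta;
  ds_det_ge : forall S, (forall v k, cyclic_perm w v -> S <> word_power v k) ->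
    eta <= `|\det (1 - word_prod B S)|;
  ds_plane : exists v1 v2 : 'cV[R]_d'.+1, [/\ P *m v1 = v1, P *m v2 = v2 &
    forall a b, a *: v1 + b *: v2 = 0 -> a = 0 /\ b = 0]
}.

Section Contraction.
Variables (R : realType) (d' m : nat) (B : 'I_m -> 'M[R]_d'.+1).
Local Notation d := d'.+1.
Local Notation W := (word_prod B).
Variables (w : seq 'I_m) (P : 'M[R]_d) (N : nat) (C eta : R).
Hypothesis sys : dominated_system B w P N C eta.

Let N_gt0 := ds_N_gt0 sys.
Let PP := ds_proj sys.
Let WP := ds_comm sys.
Let WNP := ds_period sys.
Let C_gt0 := ds_C_gt0 sys.
Let W_le := ds_norm_le sys.
Let eta_gt0 := ds_eta_gt0 sys.

(** A limit of products of the family, with high powers of [w] in place of every [P], so that bounds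
    valid for words pass to it. *)
Definition interlaced (ss : seq (seq 'I_m)) : 'M[R]_d :=
  foldr (fun s X => P *m W s *m X) P ss.

Local Notation T := interlaced.

Lemma interlaced_projl ss : P *m T ss = T ss.
Proof. by case: ss => [|s ss] /=; rewrite ?PP // !mulmxA PP. Qed.

Lemma interlaced_cat ss1 ss2 : T (ss1 ++ ss2) = T ss1 *m T ss2.
Proof.
elim: ss1 => [|s ss1 IH] /=; first by rewrite interlaced_projl.
by rewrite IH !mulmxA.
Qed.

Definition interlaced_word a (ss : seq (seq 'I_m)) :=
  word_power w (N * a) ++ flatten [seq s ++ word_power w (N * a) | s <- ss].

Lemma interlaced_word_cvg ss : mx_cvg (fun a => W (interlaced_word a ss)) (T ss).
Proof.
elim: ss => [|s ss IH] /=.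
  rewrite /interlaced_word /=; under eq_fun do rewrite cats0 word_prod_power.
  exact: (ds_limit sys).
have -> : (fun a => W (interlaced_word a (s :: ss))) =
    (fun a => W w ^+ (N * a) *m W s *m W (interlaced_word a ss)).
  apply: funext => a; rewrite /interlaced_word /= !word_prod_cat !word_prod_power.
  by rewrite !mulmxA.
apply: mx_cvgM => //; apply: mx_cvgM; last exact: mx_cvg_cst.
exact: (ds_limit sys).
Qed.

Lemma interlaced_norm_le ss : `|T ss| <= C.
Proof. by apply: (mx_cvg_norm_le (@interlaced_word_cvg ss)). Qed.

(** The approximating words are not powers of rotations of [w], by [interleaved_not_power]. The
    empty list would give [P], which fixes nonzero vectors. *)
Lemma interlaced_det_ge ss : (0 < size ss)%N -> {in ss, forall s, nontrivial w s} ->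
  eta <= `|\det (1 - T ss)|.
Proof.
move=> ss0 nt; apply: (@mx_cvg_det_ge _ _ (fun a => 1 - W (interlaced_word a ss))).
  apply: mx_cvgB; first exact: mx_cvg_cst.
  exact: interlaced_word_cvg.
move=> a a0; apply: (ds_det_ge sys) => v k wv.
apply: interleaved_not_power => //; last by rewrite muln_gt0 N_gt0.
  exact: (ds_neq_nil sys).
exact: (ds_primitive sys).
Qed.

Lemma norm_scalar1_le n : `|1%:M : 'M[R]_n| <= 1.
Proof.
by apply: mx_norm_le => // i j; rewrite mxE; case: (_ == _); rewrite ?normr1 ?normr0.
Qed.

Let fixed_bound := d%:R * (d'`!%:R * (1 + C) ^+ d') / eta.

Lemma almost_fixed_interlaced p (Y : 'M[R]_d) (Q : 'M[R]_(d, p)) :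
  `|Y| <= C -> eta <= `|\det (1 - Y)| -> `|Q| <= fixed_bound * `|Q - Y *m Q|.
Proof.
move=> YC hdet; apply: almost_fixed_le => //.
by apply: le_trans (ler_normB _ _) _; rewrite lerD // norm_scalar1_le.
Qed.

Lemma fixed_bound_gt0 : 0 < fixed_bound.
Proof.
rewrite /fixed_bound !mulr_gt0 ?invr_gt0 ?ltr0n ?fact_gt0 ?exprn_gt0 //.
by rewrite addr_gt0.
Qed.

(** Comparing suffixes puts the repeated factor [Y] on the left, where [almost_fixed_interlaced]
    applies; the prefix before the small suffix is bounded by [C]. *)
Lemma long_interlaced_small e : 0 < e -> exists2 n, (0 < n)%N &
  forall ss, size ss = n -> {in ss, forall s, nontrivial w s} -> `|T ss| <= e.
Proof.
move=> e0; pose c := e / (d%:R * C).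
have dC0 : 0 < d%:R * C by rewrite mulr_gt0.
have c0 : 0 < c by rewrite divr_gt0.
(* Two suffixes near one net point differ by at most [e' + e'], which [fixed_bound] turns into
   [c / 2]. *)
pose e' := c / (fixed_bound * 4%:R).
have e'0 : 0 < e' by rewrite divr_gt0 // mulr_gt0 ?fixed_bound_gt0.
have [s [_ hs]] : exists s : seq 'M[R]_d, (forall X, X \in s -> range T X) /\
    forall X, range T X -> exists2 Y, Y \in s & `|X - Y| <= e'.
  by apply: (finite_net (c := C)) => // _ [ss _ <-]; exact: interlaced_norm_le.
exists (size s).+1 => // ss sss nt.
have [i [j [ij js dij]]] : exists i j, [/\ (i < j)%N, (j < (size s).+1)%N &
    `|T (drop i ss) - T (drop j ss)| <= e' + e'].
  by apply: (@net_pigeonhole _ _ _ s) => // i _; apply: hs; exists (drop i ss).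
pose Y := T (take (j - i) (drop i ss)).
have ZE : T (drop i ss) = Y *m T (drop j ss).
  have -> : drop j ss = drop (j - i) (drop i ss) by rewrite drop_drop subnK // ltnW.
  by rewrite -interlaced_cat cat_take_drop.
have hdet : eta <= `|\det (1 - Y)|.
  apply: interlaced_det_ge.
    by rewrite size_takel ?size_drop ?sss; lia.
  by move=> x /mem_take /mem_drop /nt.
have := almost_fixed_interlaced (T (drop j ss)) (interlaced_norm_le _) hdet.
rewrite -ZE distrC => h.
have hZ : `|T (drop j ss)| <= c.
  apply: (le_trans h); apply: le_trans (ler_wpM2l (ltW fixed_bound_gt0) dij) _.
  have -> : fixed_bound * (e' + e') = c / 2.
    by rewrite /e'; field; rewrite gt_eqF // fixed_bound_gt0.
  by lra.
rewrite -[ss](cat_take_drop j) interlaced_cat (le_trans (mulmx_norm_le _ _)) //.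
apply: (@le_trans _ _ (d%:R * C * c)).
  by rewrite ler_pM ?mulr_ge0 // ler_wpM2l // interlaced_norm_le.
by rewrite /c mulrC divfK // gt_eqF.
Qed.

End Contraction.

Section CorePolytope.
Variables (R : realType) (d' m : nat) (B : 'I_m -> 'M[R]_d'.+1).
Local Notation d := d'.+1.
Local Notation W := (word_prod B).
Variables (w : seq 'I_m) (P : 'M[R]_d).
Implicit Types (F : seq 'cV[R]_d).

(* A symmetric polytope in the leading plane, mapped to itself by [w] and strictly
   into itself by [P *m W S] for every other word; it is the section of the
   invariant body by that plane. *)
Record core_polytope F (theta : R) : Prop := {
  cp_ge0 : 0 <= theta;
  cp_lt1 : theta < 1;
  cp_fix : forall x, x \in F -> P *m x = x;
  cp_opp : forall x, x \in F -> - x \in F;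
  cp_stable : forall x, x \in F -> W w *m x \in F;
  cp_contract : forall S x, nontrivial w S -> x \in F ->
    dilate theta (hull_seq F) (P *m W S *m x);
  cp_absorb : exists2 c, 0 < c &
    forall y, P *m y = y -> `|y| <= c -> hull_seq F y
}.

Lemma dilateN (F : seq 'cV[R]_d) c x : (forall y, y \in F -> - y \in F) ->
  dilate c (hull_seq F) x -> dilate c (hull_seq F) (- x).
Proof. by move=> FN [y Fy <-]; exists (- y); rewrite ?scalerN //; exact: hull_seqN. Qed.

Lemma dilate_sign (F : seq 'cV[R]_d) c x b : (forall y, y \in F -> - y \in F) ->
  dilate c (hull_seq F) x -> dilate c (hull_seq F) ((-1) ^+ b *: x).
Proof.
move=> FN; rewrite -signr_odd; case: (odd b); rewrite ?expr1 ?expr0 ?scaleN1r ?scale1r //.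
exact: dilateN.
Qed.

Variables (N : nat) (C eta : R).
Hypothesis sys : dominated_system B w P N C eta.
Local Notation T := (interlaced B P).

(* Products of [k < n] factors [P *m W S] get weight [n + k]; one more factor
   moves a vertex one level up, that is, strictly inside, and level [n] is small.
   Each level is replaced by a finite net. *)
Lemma core_polytope_exists : exists F theta, core_polytope F theta.
Proof.
have d0 : 0 < d%:R :> R by [].
(* At the last level, [k.+1 = n], this bound yields the factor [(n + k) / (4 * n)], below one
   half. *)
have [|n n0 hn] := long_interlaced_small sys (e := (4 * d%:R)^-1).
  by rewrite invr_gt0 mulr_gt0.
have n0R : 0 < n%:R :> R by rewrite ltr0n.
have n1R : 1 <= n%:R :> R by rewrite ler1n.
(* Moving up one level gains at least [(2 * n)^-1]. With this [delta] the net error costs at most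
   half of that; the other half is the final [1 - theta]. *)
pose delta : R := (8 * d%:R * n%:R)^-1.
have delta0 : 0 < delta by rewrite invr_gt0 !mulr_gt0.
pose E k := [set X : 'M[R]_d | exists ss,
  [/\ size ss = k, {in ss, forall s, nontrivial w s} & X = T ss]].
have /choice [net hnet] : forall k, exists s : seq 'M[R]_d,
    (forall X, X \in s -> E k X) /\
    forall X, E k X -> exists2 Y, Y \in s & `|X - Y| <= delta.
  move=> k; apply: (finite_net (c := C)) => // _ [ss [_ _ ->]].
  exact: (interlaced_norm_le sys).
(* The signs make [F] symmetric and the powers below [N] make it stable under [w]. *)
pose vertex k X (p : bool * 'I_N * 'I_d) : 'cV[R]_d :=
  (-1) ^+ p.1.1 *: ((n + k)%:R *: (W w ^+ p.1.2 *m X *m delta_mx p.2 ord0)).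
pose F := flatten [seq flatten [seq [seq vertex k X p | p <- enum {: bool * 'I_N * 'I_d}]
  | X <- net k] | k <- iota 0 n].
have memF b k (a : 'I_N) j X : (k < n)%N -> X \in net k -> vertex k X (b, a, j) \in F.
  move=> kn Xk; apply/flatten_mapP; exists k; first by rewrite mem_iota.
  apply/flatten_mapP; exists X => //; apply/mapP; exists (b, a, j) => //.
  by rewrite mem_enum.
have memFP x : x \in F -> exists b k (a : 'I_N) j X,
    [/\ (k < n)%N, X \in net k & x = vertex k X (b, a, j)].
  move=> /flatten_mapP [k]; rewrite mem_iota => /andP[_ kn].
  move=> /flatten_mapP [X Xk] /mapP [[[b a] j] _ ->].
  by exists b, k, a, j, X.
pose a0 := Ordinal (ds_N_gt0 sys).
(* [P] is the only product of level 0, so the net contains it exactly. The vectors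
   [n%:R *: (P *m delta_mx j ord0)] are therefore vertices, which gives [vec_small]. *)
have net0 : P \in net 0%N.
  have [|Y Y0 _] := (hnet 0%N).2 P; first by exists [::].
  by have [ss [/size0nil -> _ YE]] := (hnet 0%N).1 _ Y0; rewrite YE in Y0.
have FN x : x \in F -> - x \in F.
  move=> /memFP [b [k [a [j [X [kn Xk ->]]]]]].
  rewrite -scaleN1r scalerA -[_ * _]/((-1) ^+ 1 * _) -exprD -signr_odd.
  set b' := odd _; rewrite -[_ *: _]/(vertex k X (b', a, j)).
  exact: memF.
have F0 : hull_seq F 0.
  apply: (hull_seq0 (x0 := vertex 0%N P (false, a0, ord0))) => //; exact: memF.
have cK : @convex_set R 'cV[R]_d (hull_seq F) by exact: convex_hull_convex.
have netP k X : X \in net k -> exists ss,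
  [/\ size ss = k, {in ss, forall s, nontrivial w s} & X = T ss].
  exact: (hnet k).1.
have vec_small y : P *m y = y -> dilate (d%:R * `|y| / n%:R) (hull_seq F) y.
  move=> Py; have yE : y = \sum_j y j ord0 *: (P *m delta_mx j ord0).
    rewrite -{1}Py {1}(matrix_sum_delta y) mulmx_sumr; apply: eq_bigr => j _.
    by rewrite big_ord1 scalemxAr.
  have : dilate (\sum_(j < d) `|y j ord0| / n%:R) (hull_seq F) y.
    rewrite {2}yE; apply: dilate_sum => // [|j]; first by exists 0.
    exists (vertex 0%N P (y j ord0 < 0, a0, j)).
      by apply: mem_hull_seq; exact: memF.
    rewrite /vertex /= addn0 expr0 mul1mx !scalerA; congr (_ *: _).
    have [y0|y0] := ltrP (y j ord0) 0.
      by rewrite ltr0_norm // expr1; field; rewrite gt_eqF.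
    by rewrite expr0 ger0_norm //; field; rewrite gt_eqF.
  apply: dilate_le => //; first by apply: sumr_ge0 => j _; rewrite divr_ge0.
  rewrite -mulr_suml ler_pM2r ?invr_gt0 //.
  have -> : d%:R * `|y| = \sum_(j < d) `|y| by rewrite sumr_const card_ord mulr_natl.
  by apply: ler_sum => j _; exact: mx_entry_le.
have mat_small (Z : 'M[R]_d) (j : 'I_d) e : P *m Z = Z -> `|Z| <= e ->
    dilate (d%:R * e / n%:R) (hull_seq F) (Z *m delta_mx j ord0).
  move=> PZ Ze; have : P *m (Z *m delta_mx j ord0 : 'cV[R]_d) = Z *m delta_mx j ord0.
    by rewrite mulmxA PZ.
  move=> /vec_small; apply: dilate_le => //.
  rewrite ler_pM2r ?invr_gt0 // ler_pM2l // (le_trans _ Ze) //.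
  apply: mx_norm_le => // i j'; rewrite -colE mxE; exact: mx_entry_le.
exists F, (1 - (4 * n%:R)^-1); split => //.
- rewrite subr_ge0 invf_le1 ?mulr_gt0 //; lra.
- by rewrite ltrBlDr ltrDl invr_gt0 mulr_gt0.
- move=> x /memFP [b [k [a [j [X [kn /netP [ss [_ _ ->]] ->]]]]]].
  rewrite /vertex -!scalemxAr !mulmxA.
  have -> : P *m W w ^+ a = W w ^+ a *m P.
    elim: (nat_of_ord a) => [|i IH]; first by rewrite expr0 mulmx1 mul1mx.
    by rewrite exprS -mulmxE mulmxA -(ds_comm sys) -mulmxA IH mulmxA.
  by rewrite -(mulmxA _ P) (interlaced_projl sys).
- move=> x /memFP [b [k [a [j [X [kn Xk ->]]]]]].
  have [ss [_ _ XE]] := netP _ _ Xk.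
  have -> : W w *m vertex k X (b, a, j) =
     (-1) ^+ b *: ((n + k)%:R *: (W w ^+ a.+1 *m X *m delta_mx j ord0)).
    by rewrite /vertex /= -!scalemxAr !mulmxA exprS -mulmxE.
  have [aN|aN] := ltnP a.+1 N; first exact: (memF b k (Ordinal aN) j X).
  have -> : a.+1 = N by apply/eqP; rewrite eqn_leq aN ltn_ord.
  have -> : W w ^+ N *m X = W w ^+ a0 *m X.
    rewrite /= expr0 mul1mx XE -(interlaced_projl sys) mulmxA (ds_period sys).
    by [].
  exact: (memF b k a0 j X).
- move=> S x ntS /memFP [b [k [a [j [X [kn /netP [ss [sss nt XE]] ->]]]]]].
  (* The power of [w] carried by the vertex is absorbed into [S], which stays nontrivial. *)
  pose ss' := (S ++ word_power w a) :: ss.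
  have nt' : {in ss', forall s, nontrivial w s}.
    by move=> s; rewrite inE => /orP[/eqP->|/nt //]; exact: nontrivial_catr.
  have -> : P *m W S *m vertex k X (b, a, j) =
      (-1) ^+ b *: ((n + k)%:R *: (T ss' *m delta_mx j ord0)).
    rewrite /vertex /= -!scalemxAr word_prod_cat word_prod_power XE.
    by rewrite !mulmxA.
  apply: dilate_sign => //.
  have knR : (n + k)%:R + 1 <= 2 * n%:R :> R.
    by rewrite natr1 -natrM ler_nat; lia.
  have k0R : 0 <= k%:R :> R by [].
  have nkR : 0 < (n + k)%:R :> R by rewrite ltr0n addn_gt0 n0.
  have [kn1|kn1] := ltnP k.+1 n.
    have [|Y Yk dY] := (hnet k.+1).2 (T ss'); first by exists ss'; rewrite /= sss.
    have -> : (n + k)%:R *: (T ss' *m delta_mx j ord0) =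
        ((n + k)%:R / (n + k.+1)%:R) *: vertex k.+1 Y (false, a0, j) +
        (n + k)%:R *: ((T ss' - Y) *m delta_mx j ord0).
      rewrite /vertex /= expr0 scale1r expr0 mul1mx scalerA divfK ?pnatr_eq0 ?addnS //.
      by rewrite -scalerDr mulmxBl addrC subrK.
    have h1 : dilate ((n + k)%:R / (n + k.+1)%:R) (hull_seq F)
        (((n + k)%:R / (n + k.+1)%:R) *: vertex k.+1 Y (false, a0, j)).
      by exists (vertex k.+1 Y (false, a0, j)) => //; apply: mem_hull_seq; exact: memF.
    have h2 : dilate ((n + k)%:R * (d%:R * delta / n%:R)) (hull_seq F)
        ((n + k)%:R *: ((T ss' - Y) *m delta_mx j ord0)).
      rewrite -dilate_dilate; eexists; last by [].
      apply: mat_small => //; have [ssY [_ _ ->]] := netP _ _ Yk.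
      by rewrite mulmxBr !(interlaced_projl sys).
    have p1 : 0 <= (n + k)%:R / (n + k.+1)%:R :> R by rewrite divr_ge0.
    have p2 : 0 <= (n + k)%:R * (d%:R * delta / n%:R).
      by rewrite mulr_ge0 // divr_ge0 // mulr_ge0 // ltW.
    have := dilateD cK p1 p2 h1 h2; apply: dilate_le => //.
    + by rewrite addr_ge0.
    + have -> : (n + k.+1)%:R = (n + k)%:R + 1 :> R by rewrite addnS -natr1.
      move: nkR knR; set c := (n + k)%:R : R => c0 c2.
      have b1 : c / (c + 1) <= 1 - (2 * n%:R)^-1.
        rewrite ler_pdivrMr; last lra.
        rewrite mulrBl mul1r.
        have : (2 * n%:R)^-1 * (c + 1) <= 1.
          by rewrite mulrC ler_pdivrMr ?mulr_gt0 // mul1r.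
        lra.
      have b2 : c * (d%:R * delta / n%:R) <= (4 * n%:R)^-1.
        have -> : d%:R * delta / n%:R = (8 * n%:R * n%:R)^-1.
          by rewrite /delta; field; rewrite !gt_eqF.
        rewrite -ler_pdivlMr ?invr_gt0 ?mulr_gt0 // invrK.
        have -> : (4 * n%:R)^-1 * (8 * n%:R * n%:R) = 2 * n%:R :> R.
          by field; rewrite gt_eqF.
        lra.
      have b3 : (2 * n%:R)^-1 = 2 * (4 * n%:R)^-1 :> R by field; rewrite gt_eqF.
      lra.
  have kE : k.+1 = n by apply/eqP; rewrite eqn_leq kn1 kn.
  have h : dilate ((n + k)%:R * (d%:R * (4 * d%:R)^-1 / n%:R)) (hull_seq F)
      ((n + k)%:R *: (T ss' *m delta_mx j ord0)).
    rewrite -dilate_dilate; eexists; last by [].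
    apply: mat_small; first exact: (interlaced_projl sys).
    by apply: hn => //; rewrite /= sss.
  apply: dilate_le h => //.
  have -> : d%:R * (4 * d%:R)^-1 / n%:R = (4 * n%:R)^-1 :> R.
    by field; rewrite !gt_eqF.
  rewrite ler_pdivrMr ?mulr_gt0 // mulrBl mulVf ?mul1r ?gt_eqF ?mulr_gt0 //.
  lra.
- exists (n%:R / d%:R); first by rewrite divr_gt0.
  move=> y Py yc; rewrite -[hull_seq F]dilate1; apply: (dilate_le _ _ _ _ (vec_small _ Py)) => //.
  by rewrite ler_pdivrMr // mul1r mulrC -ler_pdivlMr.
Qed.

End CorePolytope.

(** * Invariant polytopes *)

Section AbsolutelyConvex.
Variables (R : realType) (n : nat) (G : set 'cV[R]_n).
Hypothesis G_convex : @convex_set R 'cV[R]_n G.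
Hypothesis G_opp : forall x, G x -> G (- x).
Hypothesis G_0 : G 0.

Lemma dilate_scale c x : G x -> dilate `|c| G (c *: x).
Proof.
move=> Gx; have [c0|c0] := ltrP c 0.
  by exists (- x); rewrite ?ltr0_norm // ?scaleNr ?scalerN ?opprK //; exact: G_opp.
by exists x; rewrite ?ger0_norm.
Qed.

(** Each coordinate vector lies in some dilate of [G]; adding the factors places a small cube inside
    [G]. *)
Lemma absorbing_of_span (bs : seq 'cV[R]_n) : <<bs>>%VS = fullv ->
  (forall x, x \in bs -> G x) -> exists2 r, 0 < r & forall y, `|y| <= r -> G y.
Proof.
move=> sp sG; pose X := in_tuple bs.
pose c (j : 'I_n) := \sum_i `|coord X i (delta_mx j ord0)|.
have c0 j : 0 <= c j by exact: sumr_ge0.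
have hc j : dilate (c j) G (delta_mx j ord0).
  have : delta_mx j ord0 \in <<X>>%VS by rewrite sp memvf.
  move/coord_span => e; rewrite e; apply: dilate_sum => //; first by exists 0.
  by move=> i; apply: dilate_scale; apply: sG; apply: mem_nth; exact: ltn_ord.
have S0 : 0 <= \sum_j c j by exact: sumr_ge0.
exists (1 + \sum_j c j)^-1 => [|y yr]; first by rewrite invr_gt0 ltr_wpDr.
rewrite -[G]dilate1.
have : dilate (\sum_j `|y j ord0| * c j) G y.
  rewrite {2}(matrix_sum_delta y); apply: dilate_sum => //; first by exists 0.
    by move=> j; rewrite mulr_ge0.
  move=> j; rewrite big_ord1; have [z Gz <-] := hc j.
  rewrite -dilate_dilate scalerA mulrC -scalerA.
  have [u Gu <-] := dilate_scale (y j ord0) Gz.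
  by rewrite dilate_dilate mulrC -dilate_dilate; exists (`|y j ord0| *: u) => //; exists u.
apply: dilate_le => //; first by apply: sumr_ge0 => j _; rewrite mulr_ge0.
apply: (@le_trans _ _ (\sum_j (1 + \sum_j c j)^-1 * c j)).
  apply: ler_sum => j _; rewrite ler_wpM2r //; apply: le_trans yr; exact: mx_entry_le.
rewrite -mulr_sumr mulrC ler_pdivrMr ?mul1r ?lerDr //.
by rewrite ltr_wpDr.
Qed.

End AbsolutelyConvex.

Section InvariantPolytope.
Variables (R : realType) (d' m : nat) (B : 'I_m -> 'M[R]_d'.+1).
Local Notation d := d'.+1.
Local Notation W := (word_prod B).
Variables (w : seq 'I_m) (P : 'M[R]_d) (N : nat) (C eta : R).
Hypothesis sys : dominated_system B w P N C eta.
Variables (F : seq 'cV[R]_d) (theta : R).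
Hypothesis cp : core_polytope B w P F theta.

Definition words_below n : seq (seq 'I_m) :=
  flatten [seq [seq tval t | t <- enum {: k.-tuple 'I_m}] | k <- iota 0 n].

Lemma mem_words_below n s : (s \in words_below n) = (size s < n)%N.
Proof.
apply/flatten_mapP/idP => [[k]|sn].
  rewrite mem_iota => /andP[_ kn] /mapP[t _ ->]; rewrite size_tuple; exact: kn.
exists (size s); first by rewrite mem_iota.
by apply/mapP; exists (in_tuple s); rewrite ?mem_enum.
Qed.

Definition vertices n : seq 'cV[R]_d := [seq W s *m x | s <- words_below n, x <- F].

Local Notation body n := (hull_seq (vertices n)).

Lemma mem_vertices n s x : (size s < n)%N -> x \in F -> W s *m x \in vertices n.
Proof. by move=> sn xF; apply: allpairs_f => //; rewrite mem_words_below. Qed.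

Lemma verticesP n y : y \in vertices n ->
  exists s x, [/\ (size s < n)%N, x \in F & y = W s *m x].
Proof.
by move=> /allpairsP [[s x] /= [sn xF ->]]; exists s, x; rewrite -mem_words_below.
Qed.

Lemma vertices_opp n y : y \in vertices n -> - y \in vertices n.
Proof.
move=> /verticesP [s [x [sn xF ->]]]; rewrite -mulmxN.
by apply: mem_vertices => //; exact: (cp_opp cp).
Qed.

Lemma body_mono n n' : (n <= n')%N -> body n `<=` body n'.
Proof.
move=> nn'; apply: hull_seq_min; first exact: convex_hull_convex.
move=> y /verticesP [s [x [sn xF ->]]]; apply: mem_hull_seq.
by apply: mem_vertices => //; exact: leq_trans nn'.
Qed.

Lemma core_neq0 : exists2 x, x \in F & x != 0.
Proof.
apply: contrapT => hF; have [v1 [v2 [Pv1 _ ind]]] := ds_plane sys.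
have [c c0 hc] := cp_absorb cp.
have v10 : v1 != 0.
  apply/eqP => v0; have [] := ind 1 0; first by rewrite v0 scaler0 scale0r addr0.
  by move/eqP; rewrite oner_eq0.
have : hull_seq F ((c / `|v1|) *: v1).
  apply: hc; first by rewrite -scalemxAr Pv1.
  by rewrite normrZ normrM normfV normr_id divfK ?normr_eq0 // ger0_norm // ltW.
have /(_ _) h : hull_seq F `<=` [set 0].
  apply: hull_seq_min.
    by apply/convex_setP => x y t _ _ -> ->; rewrite !scaler0 addr0.
  by move=> x xF /=; apply: contrapT => /eqP x0; apply: hF; exists x.
move/h => /= /eqP; rewrite scaler_eq0 (negPf v10) orbF mulf_eq0 invr_eq0.
by rewrite normr_eq0 (negPf v10) gt_eqF.
Qed.

(** By irreducibility finitely many images of one nonzero point of [F] span the space. *)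
Lemma body_absorbing : exists n r, [/\ (0 < n)%N, 0 < r & forall y, `|y| <= r -> body n y].
Proof.
have [x xF x0] := core_neq0; have [ss sp] := irreducible_span (ds_irreducible sys) x0.
pose n := (\max_(s <- ss) size s).+1.
have [||||r r0 hr] := absorbing_of_span (G := body n) _ _ _ sp.
- exact: convex_hull_convex.
- by apply: hull_seqN => y; exact: vertices_opp.
- apply: (hull_seq0 (x0 := W [::] *m x)); first exact: vertices_opp.
  exact: mem_vertices.
- move=> _ /mapP [s sss ->]; apply: mem_hull_seq; apply: mem_vertices => //.
  by rewrite ltnS (big_rem s) //= leq_maxl.
by exists n, r.
Qed.

Lemma stable_power x k : x \in F -> W w ^+ k *m x \in F.
Proof.
move=> xF; elim: k => [|k IH]; first by rewrite mul1mx.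
by rewrite exprS -mulmxE -mulmxA; exact: (cp_stable cp).
Qed.

(* Along a long word either some suffix product is small, or two suffix products
   nearly agree; then the word between them nearly fixes a large matrix, so it is
   a power of a rotation of [w] and pushes the vertex close to the range of [P]. *)
Lemma long_word_suffix n r : (0 < n)%N -> 0 < r -> (forall y, `|y| <= r -> body n y) ->
  exists2 n', (n <= n')%N & forall s, size s = n' -> exists u v,
    [/\ s = u ++ v, (n <= size v)%N & forall x, x \in F -> body n (W v *m x)].
Proof.
move=> n0 r0 hr.
have d0 : 0 < d%:R :> R by [].
have C0 := ds_C_gt0 sys.
pose M := 1 + \sum_(x <- F) `|x|.
have M0 : 0 < M by rewrite ltr_wpDr // sumr_ge0.
have hM x : x \in F -> `|x| <= M.
  by move=> xF; rewrite /M (big_rem x) //= addrCA lerDl addr_ge0 // sumr_ge0.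
have [K K0 hK] : exists2 K, 0 < K & forall Y Q : 'M[R]_d, `|Y| <= C ->
    eta <= `|\det (1 - Y)| -> `|Q| <= K * `|Q - Y *m Q|.
  by eexists; [exact: (fixed_bound_gt0 sys)|move=> *; exact: (almost_fixed_interlaced sys)].
(* A product of norm at most [c] maps [F] into the ball of radius [r]. *)
pose c := r / (d%:R * M); have c0 : 0 < c by rewrite divr_gt0 ?mulr_gt0.
have e0 : 0 < c / (K * 4) by apply: divr_gt0 => //; exact: mulr_gt0.
have th1 : 0 < 1 - theta by rewrite subr_gt0 (cp_lt1 cp).
(* Replacing a power of [w] by [P] with this accuracy moves an image of a point of [F] by at most
   [(1 - theta) * r]. *)
pose e2 := (1 - theta) * r / (d%:R * (d%:R * C) * M).
have e20 : 0 < e2 by rewrite divr_gt0 ?mulr_gt0.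
have [k0 hk0] := mx_cvg_eventually e20 (ds_limit sys).
have [net [_ hnet]] : exists s : seq 'M[R]_d, (forall X, X \in s -> range W X) /\
    forall X, range W X -> exists2 Y, Y \in s & `|X - Y| <= c / (K * 4).
  by apply: (finite_net (c := C)) => // _ [s _ <-]; exact: (ds_norm_le sys).
(* Between two cuts at multiples of [D], a power of a rotation of [w] contains [N * k0] consecutive
   copies of [w]; one more copy is lost to the rotation. *)
pose D := (size w * (N * k0).+1)%N.
exists (n + D * size net)%N => [|s ss]; first exact: leq_addr.
pose Z i := drop (D * i) s.
have sZ i : (i <= size net)%N -> (n <= size (Z i))%N.
  by move=> ik; rewrite size_drop ss -addnBA ?leq_addr // leq_mul2l ik orbT.
have [[i ik hi]|hbig] := pselect (exists2 i, (i <= size net)%N & `|W (Z i)| <= c).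
  exists (take (D * i) s), (Z i); split; [by rewrite cat_take_drop|exact: sZ|].
  move=> x xF; apply: hr; apply: le_trans (mulmx_norm_le _ _) _.
  apply: (@le_trans _ _ (d%:R * c * M)).
    by rewrite ler_pM ?mulr_ge0 // ?ler_wpM2l // hM.
  by rewrite /c le_eqVlt; apply/orP; left; apply/eqP; field; rewrite !gt_eqF.
have [i [j [ij jk dij]]] : exists i j, [/\ (i < j)%N, (j < (size net).+1)%N &
    `|W (Z i) - W (Z j)| <= c / (K * 4) + c / (K * 4)].
  by apply: (@net_pigeonhole _ _ _ net) => // i _; apply: hnet; exists (Z i).
pose X := take (D * (j - i)) (Z i).
have ZE : Z i = X ++ Z j.
  have -> : Z j = drop (D * (j - i)) (Z i).
    by rewrite drop_drop -mulnDr subnK // ltnW.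
  by rewrite cat_take_drop.
have sX : size X = (D * (j - i))%N.
  rewrite size_takel // size_drop ss mulnBr leq_sub2r //.
  by apply: leq_trans (leq_addl _ _); rewrite leq_mul2l -ltnS jk orbT.
have [v [k [[q ->] XE]]] : exists v k, cyclic_perm w v /\ X = word_power v k.
  apply: contrapT => nX; apply: hbig; exists j => //.
  have hdet : eta <= `|\det (1 - W X)|.
    by apply: (ds_det_ge sys) => v k wv Xv; apply: nX; exists v, k.
  have := hK (W X) (W (Z j)) (ds_norm_le sys X) hdet.
  rewrite -word_prod_cat -ZE distrC => h; apply: (le_trans h).
  apply: le_trans (ler_wpM2l (ltW K0) dij) _.
  have -> : K * (c / (K * 4) + c / (K * 4)) = c / 2 by field; rewrite gt_eqF.
  lra.
have w0 : (0 < size w)%N by case: (w) (ds_neq_nil sys).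
have kk : (N * k0 < k)%N.
  have : (size w * (N * k0).+1 <= k * size w)%N.
    have := congr1 size XE; rewrite size_word_power size_rot sX => <-.
    by rewrite /D leq_pmulr // subn_gt0.
  by rewrite mulnC leq_pmul2r.
pose b := (k - (N * k0).+1)%N.
have kE : k = (N * k0 + b).+1 by rewrite -addSn subnKC.
pose u := word_power w b ++ take q w ++ Z j.
have sE : s = (take (D * i) s ++ drop q w) ++ word_power w (N * k0) ++ u.
  rewrite -[LHS](cat_take_drop (D * i)) -/(Z i) ZE XE kE /rot word_power_rot.
  by rewrite cat_take_drop word_powerD /u !catA.
exists (take (D * i) s ++ drop q w), (word_power w (N * k0) ++ u); split => //.
  by apply: leq_trans (sZ j jk) _; rewrite /u !size_cat !addnA leq_addl.
move=> x xF.
have [[b' ub]|nu] := pselect (exists b, u = word_power w b).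
  rewrite ub -word_powerD word_prod_power -[_ *m _]mul1mx -(word_prod_nil B).
  by apply: mem_hull_seq; apply: mem_vertices => //; exact: stable_power.
have ntu : nontrivial w u by move=> b' ub; apply: nu; exists b'.
have FG : hull_seq F `<=` body n.
  apply: hull_seq_min; first exact: convex_hull_convex.
  move=> y yF; rewrite -[y]mul1mx -(word_prod_nil B); apply: mem_hull_seq.
  exact: mem_vertices.
have h1 := dilate_sub FG (cp_contract cp ntu xF).
rewrite word_prod_cat word_prod_power.
set Q := W w ^+ (N * k0).
(* The first summand lies in [theta] times the body, and the accuracy [e2] puts the second into
   [1 - theta] times the body. *)
have -> : Q *m W u *m x = P *m W u *m x + (Q - P) *m W u *m x.
  by rewrite !mulmxBl addrC subrK.
have h2 : dilate (1 - theta) (body n) ((Q - P) *m W u *m x).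
  exists ((1 - theta)^-1 *: ((Q - P) *m W u *m x)); last first.
    by rewrite scalerA divff ?scale1r // gt_eqF.
  apply: hr; rewrite normrZ normfV gtr0_norm // ler_pdivrMl //.
  apply: le_trans (mulmx_norm_le _ _) _.
  apply: (@le_trans _ _ (d%:R * (d%:R * e2 * C) * M)).
    rewrite ler_pM ?mulr_ge0 // ?hM // ler_wpM2l // (le_trans (mulmx_norm_le _ _)) //.
    by rewrite ler_pM ?mulr_ge0 ?(ds_norm_le sys) // ler_wpM2l // hk0.
  by rewrite /e2 le_eqVlt; apply/orP; left; apply/eqP; field; rewrite !gt_eqF.
rewrite -[body n]dilate1 -[1](subrK theta) addrC [X in dilate X](_ : _ = theta + (1 - theta)); last by ring.
apply: dilateD => //; [exact: convex_hull_convex|exact: (cp_ge0 cp)|exact: ltW].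
Qed.

(** The suffix [v] of a long word maps a point of [F] into the hull of images under words shorter
    than [n]. As [n <= size v], replacing [v] by these shortens the word, and induction on the
    length applies. *)
Lemma finite_invariant_body : exists n r, [/\ 0 < r,
  forall y, `|y| <= r -> body n y &
  forall s x, x \in F -> body n (W s *m x)].
Proof.
have [n [r [n0 r0 hr]]] := body_absorbing.
have [n' nn' hn'] := long_word_suffix n0 r0 hr.
exists n', r; split=> // [y /hr|s x xF]; first exact: body_mono.
have [k] := ubnP (size s); elim: k s x xF => // k IH s x xF sk.
have [sn|sn] := ltnP (size s) n'.
  by apply: mem_hull_seq; exact: mem_vertices.
have [|u [v [suv nv hv]]] := hn' (drop (size s - n') s).
  by rewrite size_drop subKn.
have sE : s = (take (size s - n') s ++ u) ++ v.
  by rewrite -catA -suv cat_take_drop.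
rewrite sE word_prod_cat -mulmxA.
apply: (hull_seq_mulmx _ _ (hv x xF)); first exact: convex_hull_convex.
move=> _ /verticesP [s1 [x1 [s1n x1F ->]]]; rewrite mulmxA -word_prod_cat.
apply: IH => //; move: sk; rewrite {1}sE !size_cat; lia.
Qed.

End InvariantPolytope.

Section PolytopeBody.
Variables (R : realType) (d' m : nat) (B : 'I_m -> 'M[R]_d'.+1).
Local Notation d := d'.+1.
Local Notation W := (word_prod B).
Variables (w : seq 'I_m) (P : 'M[R]_d) (N : nat) (C eta : R).
Hypothesis sys : dominated_system B w P N C eta.

(* The segment [-x, x] is the degenerate ellipse [ellipse x 0]. *)
Lemma hull_of_ellipses_polytope n (V : seq 'cV[R]_n) :
  (forall x, x \in V -> - x \in V) -> hull_of_ellipses (hull_seq V).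
Proof.
move=> VN; exists (size V), (fun k => nth 0 V k), (fun=> 0).
have cV := @convex_hull_convex R n [set x | x \in V].
apply/seteqP; split.
  apply: hull_seq_min; first exact: convex_hull_convex.
  move=> x xV; apply: sub_convex_hull.
  have kV : (index x V < size V)%N by rewrite index_mem.
  exists (Ordinal kV) => //; exists 0 => //=.
  by rewrite cos0 scale1r scaler0 addr0 nth_index.
apply: convex_hull_min => // _ [k _ [t _ <-]] /=; rewrite scaler0 addr0.
have kV : nth 0 V k \in V by exact: mem_nth.
have VN' := hull_seqN VN.
have hk : hull_seq V (nth 0 V k) by exact: mem_hull_seq.
have := dilate_scale VN' (cos t) hk; rewrite -[X in _ -> X _]dilate1.
by apply: dilate_le => //; [exact: hull_seq0 kV|rewrite ler_norml cos_geN1 cos_le1].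
Qed.

(** The last two clauses make the core the image of the body under [P], by which different bodies
    are told apart. *)
Lemma polytope_body F theta : core_polytope B w P F theta ->
  exists G : set 'cV[R]_d,
  [/\ symmetric_convex_body G,
      convex_hull (\bigcup_k (mulmx (B k) @` G)) = G,
      hull_of_ellipses G,
      forall x, x \in F -> G x &
      forall x, G x -> hull_seq F (P *m x)].
Proof.
move=> cp; have [n [r [r0 hr stable]]] := finite_invariant_body sys cp.
have cG := @convex_hull_convex R d [set x | x \in vertices B F n].
have VN := vertices_opp (B := B) (n := n) cp.
have FG x : x \in F -> hull_seq (vertices B F n) x.
  by move=> xF; rewrite -[x]mul1mx -(word_prod_nil B); exact: stable.
exists (hull_seq (vertices B F n)); split => //.
- split=> //.
  + exact: hull_seq_compact.
  + exists 0; apply/nbhs_ballP; exists r => // y.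
    by rewrite -ball_normE /= sub0r normrN => /ltW; exact: hr.
  + exact: hull_seqN.
- apply/seteqP; split.
    apply: convex_hull_min => // _ [k _ [x Gx <-]].
    apply: (hull_seq_mulmx cG _ Gx) => _ /verticesP [s [y [_ yF ->]]].
    by rewrite mulmxA -word_prod_cons; exact: stable.
  apply: hull_seq_min; first exact: convex_hull_convex.
  have imG k s y : y \in F -> (\bigcup_k (mulmx (B k) @` hull_seq (vertices B F n)))
      (W (k :: s) *m y).
    move=> yF; exists k => //; exists (W s *m y); first exact: stable.
    by rewrite word_prod_cons mulmxA.
  move=> _ /verticesP [[|k s] [y [_ yF ->]]]; apply: sub_convex_hull; last exact: imG.
  (* The empty word has no first letter, but [y] has period [N] under [w], so it is also an image
     under the first letter of [w]. *)
  rewrite word_prod_nil mul1mx.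
  have <- : W (word_power w N) *m y = y.
    by rewrite word_prod_power -(cp_fix cp yF) mulmxA (ds_period sys).
  case: (N) (ds_N_gt0 sys) => // N' _; rewrite word_powerS.
  by case: (w) (ds_neq_nil sys) => // k s _; exact: imG.
- exact: hull_of_ellipses_polytope.
- move=> x; apply: hull_seq_mulmx; first exact: convex_hull_convex.
  move=> _ /verticesP [s [y [_ yF ->]]].
  have [[b ->]|nt] := pselect (exists b, s = word_power w b).
    rewrite word_prod_power; have yF' := stable_power cp b yF.
    by rewrite (cp_fix cp yF'); exact: mem_hull_seq.
  have ntS : nontrivial w s by move=> b sb; apply: nt; exists b.
  have := cp_contract cp ntS yF; rewrite -mulmxA -[X in _ -> X _]dilate1.
  apply: dilate_le; first exact: convex_hull_convex.
  + exact: (hull_seq0 (cp_opp cp) yF).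
  + exact: (cp_ge0 cp).
  + exact: ltW (cp_lt1 cp).
Qed.

End PolytopeBody.

(** * Non-homothetic bodies *)

Section AveragedForm.
Variables (R : realType) (n : nat) (Q : 'M[R]_n.+1) (N : nat).
Implicit Types x y z : 'cV[R]_n.+1.

(* Averaging over the period makes [Q] an isometry of the leading plane. *)
Definition avg_form x y : R :=
  \sum_(j < N) \sum_i (Q ^+ j *m x) i ord0 * (Q ^+ j *m y) i ord0.

Lemma avg_formC x y : avg_form x y = avg_form y x.
Proof. by apply: eq_bigr => j _; apply: eq_bigr => i _; rewrite mulrC. Qed.

Lemma avg_form_lin a b x y z :
  avg_form (a *: x + b *: y) z = a * avg_form x z + b * avg_form y z.
Proof.
rewrite /avg_form !mulr_sumr -big_split; apply: eq_bigr => j _ /=.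
rewrite !mulr_sumr -big_split; apply: eq_bigr => i _ /=.
rewrite mulmxDr -!scalemxAr; move: (Q ^+ j *m x) (Q ^+ j *m y) (Q ^+ j *m z).
by move=> u v t; rewrite !mxE; ring.
Qed.

Lemma avg_form_sq a b x y : avg_form (a *: x + b *: y) (a *: x + b *: y) =
  a ^+ 2 * avg_form x x + 2 * (a * b) * avg_form x y + b ^+ 2 * avg_form y y.
Proof.
rewrite avg_form_lin (avg_formC x) (avg_formC y (_ + _)) !avg_form_lin.
rewrite (avg_formC y x); ring.
Qed.

Lemma avg_form_ge0 x : 0 <= avg_form x x.
Proof.
by apply: sumr_ge0 => j _; apply: sumr_ge0 => i _; rewrite -expr2 sqr_ge0.
Qed.

Lemma avg_formZ c x : avg_form (c *: x) (c *: x) = c ^+ 2 * avg_form x x.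
Proof.
rewrite -[c *: x]addr0 -(scale0r x) avg_form_sq; ring.
Qed.

Lemma avg_form_cauchy x y : 2 * avg_form x y <= avg_form x x + avg_form y y.
Proof.
have := avg_form_ge0 (1 *: x + (-1) *: y); rewrite avg_form_sq; lra.
Qed.

Lemma avg_form_eq0 x : (0 < N)%N -> avg_form x x <= 0 -> x = 0.
Proof.
move=> N0 x0; have /eqP : avg_form x x = 0.
  by apply/eqP; rewrite eq_le x0 avg_form_ge0.
rewrite psumr_eq0 => [/allP h|j _]; last first.
  by apply: sumr_ge0 => i _; rewrite -expr2 sqr_ge0.
have := h (Ordinal N0) (mem_index_enum _); rewrite /= psumr_eq0 => [/allP {}h|i _].
  apply/matrixP => i j; rewrite (ord1 j) mxE.
  have := h i (mem_index_enum _).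
  by rewrite /= expr0 mul1mx mulf_eq0 orbb => /eqP.
by rewrite -expr2 sqr_ge0.
Qed.

(** Applying [Q] permutes the summands cyclically. *)
Lemma avg_form_invariant x : (0 < N)%N -> Q ^+ N *m x = x ->
  avg_form (Q *m x) (Q *m x) = avg_form x x.
Proof.
rewrite /avg_form; case: N => // N' _ Qx.
pose g j := \sum_i (Q ^+ j *m x) i ord0 * (Q ^+ j *m x) i ord0.
rewrite -[RHS]/(\sum_(j < N'.+1) g j).
have -> : \sum_(j < N'.+1) \sum_i (Q ^+ j *m (Q *m x)) i ord0 * (Q ^+ j *m (Q *m x)) i ord0
    = \sum_(j < N'.+1) g j.+1.
  by apply: eq_bigr => j _; rewrite /g mulmxA mulmxE -exprSr.
rewrite big_ord_recr /= [RHS]big_ord_recl addrC; congr (_ + _).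
by rewrite /g Qx expr0 mul1mx.
Qed.

Lemma avg_form_convex M : @convex_set R 'cV[R]_n.+1 [set x | avg_form x x <= M].
Proof.
apply/convex_setP => x y t t0 t1 /= hx hy; rewrite avg_form_sq.
have := avg_form_cauchy x y.
move: (avg_form x x) (avg_form y y) (avg_form x y) hx hy => a b c ha hb hc.
have h : t * (1 - t) * (2 * c) <= t * (1 - t) * (a + b).
  by rewrite ler_wpM2l // mulr_ge0 // subr_ge0.
have h1 := ler_wpM2l t0 ha.
have s0 : 0 <= 1 - t by rewrite subr_ge0.
have h2 := ler_wpM2l s0 hb.
have -> : t ^+ 2 * a + 2 * (t * (1 - t)) * c + (1 - t) ^+ 2 * b =
  t * (1 - t) * (2 * c) + (t ^+ 2 * a + (1 - t) ^+ 2 * b) by ring.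
have e : t * (1 - t) * (a + b) + (t ^+ 2 * a + (1 - t) ^+ 2 * b) = t * a + (1 - t) * b by ring.
lra.
Qed.

Lemma avg_form_halfspace z c : @convex_set R 'cV[R]_n.+1 [set x | avg_form x z <= c].
Proof.
apply/convex_setP => x y t t0 t1 /= hx hy; rewrite avg_form_lin.
have h1 := ler_wpM2l t0 hx.
have s0 : 0 <= 1 - t by rewrite subr_ge0.
have h2 := ler_wpM2l s0 hy.
lra.
Qed.

End AveragedForm.

Lemma seq_argmax (T : eqType) (R : realType) (f : T -> R) (s : seq T) x0 : x0 \in s ->
  exists2 x, x \in s & forall y, y \in s -> f y <= f x.
Proof.
elim: s x0 => // a [|b s] IH x0 _.
  by exists a; rewrite ?mem_head // => y; rewrite inE => /eqP ->.
have [x xs hx] := IH b (mem_head _ _).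
have [le|lt] := lerP (f a) (f x).
  exists x; first by rewrite inE xs orbT.
  by move=> y; rewrite inE => /orP[/eqP->|/hx].
exists a; first exact: mem_head.
move=> y; rewrite inE => /orP[/eqP-> //|/hx h]; exact: le_trans h (ltW lt).
Qed.

Section Homotheties.
Variables (R : realType) (d' m : nat) (B : 'I_m -> 'M[R]_d'.+1).
Local Notation d := d'.+1.
Local Notation W := (word_prod B).
Variables (w : seq 'I_m) (P : 'M[R]_d) (N : nat) (C eta : R).
Hypothesis sys : dominated_system B w P N C eta.
Variables (F : seq 'cV[R]_d) (theta : R).
Hypothesis cp : core_polytope B w P F theta.
Local Notation form := (avg_form (W w) N).
Let N_gt0 := ds_N_gt0 sys.

(* Otherwise [F] would contain the whole sphere of the strictly convex form. *)
Lemma point_outside_core : exists x0 z,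
  [/\ x0 \in F, forall x, x \in F -> form x x <= form x0 x0,
      P *m z = z, ~ hull_seq F z & form z z < form x0 x0].
Proof.
have [y0 y0F y00] := core_neq0 sys cp.
have [x0 x0F hmax] := seq_argmax (fun x => form x x) y0F.
exists x0; set M := form x0 x0 in hmax *.
have M0 : 0 < M.
  rewrite ltNge; apply/negP => M0; case/eqP: y00.
  by apply: avg_form_eq0 N_gt0 (le_trans (hmax _ y0F) M0).
apply: contrapT => hz.
have inF z : P *m z = z -> form z z < M -> hull_seq F z.
  by move=> Pz zM; apply: contrapT => nz; apply: hz; exists z.
have sphere z : P *m z = z -> form z z = M -> z \in F.
  (* If [form x1 z] reaches [M], the equality case of Cauchy-Schwarz gives [x1 = z]. Otherwise a
     half-space contains the hull but not the point [t *: z], whose form is below [M]. *)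
  move=> Pz zM; have [x1 x1F hx1] := seq_argmax (fun x => form x z) x0F.
  have m0 : 0 <= form x1 z.
    have := hx1 _ (cp_opp cp x1F).
    have -> : - x1 = (-1) *: x1 + 0 *: x1 by rewrite scale0r addr0 scaleN1r.
    rewrite avg_form_lin; lra.
  have [lt|ge] := ltrP (form x1 z) M; last first.
    have qx := hmax _ x1F.
    have : form (1 *: x1 + (-1) *: z) (1 *: x1 + (-1) *: z) <= 0.
      rewrite avg_form_sq zM; lra.
    move/(avg_form_eq0 N_gt0)/eqP; rewrite scale1r scaleN1r subr_eq0 => /eqP <-.
    exact: x1F.
  pose t := (form x1 z + M) / (2 * M).
  have t1 : t < 1 by rewrite ltr_pdivrMr ?mulr_gt0 //; lra.
  have t0 : 0 <= t by rewrite divr_ge0 // ?mulr_ge0 ?addr_ge0 // ltW.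
  have : hull_seq F (t *: z).
    apply: inF; first by rewrite -scalemxAr Pz.
    rewrite avg_formZ zM gtr_pMl // expr2; nra.
  have sub : hull_seq F `<=` [set x | form x z <= form x1 z].
    by apply: hull_seq_min => //; exact: avg_form_halfspace.
  move=> /sub /=; rewrite -[t *: z]addr0 -(scale0r z) avg_form_lin zM mul0r addr0.
  have -> : t * M = (form x1 z + M) / 2 by rewrite /t; field; rewrite gt_eqF.
  lra.
have [v1 [v2 [Pv1 Pv2 ind]]] := ds_plane sys.
(* These vectors are pairwise not proportional; scaled to the sphere they would be infinitely many
   members of the list [F]. *)
pose y k := v1 + k%:R *: v2.
have y_neq0 k : 0 < form (y k) (y k).
  rewrite lt_neqAle avg_form_ge0 andbT; apply/eqP => e.
  have /(avg_form_eq0 N_gt0) yk0 : form (y k) (y k) <= 0 by rewrite -e.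
  have [] := ind 1 k%:R; first by rewrite scale1r.
  by move/eqP; rewrite oner_eq0.
pose sc k := Num.sqrt (M / form (y k) (y k)).
have sc0 k : 0 < sc k by rewrite sqrtr_gt0 divr_gt0.
have ykF k : sc k *: y k \in F.
  apply: sphere.
    by rewrite -scalemxAr mulmxDr -scalemxAr Pv1 Pv2.
  by rewrite avg_formZ sqr_sqrtr ?divfK ?gt_eqF // divr_ge0 // ltW.
have inj : injective (fun k => sc k *: y k).
  move=> k l /= e.
  have : (sc k - sc l) *: v1 + (sc k * k%:R - sc l * l%:R) *: v2 = 0.
    rewrite !scalerBl -!scalerA addrACA -opprD -!scalerDr -/(y k) -/(y l) e.
    exact: subrr.
  move=> /ind [/eqP]; rewrite subr_eq0 => /eqP <- /eqP.
  by rewrite -mulrBr mulf_eq0 gt_eqF //= subr_eq0 eqr_nat => /eqP.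
have : (size [seq sc k *: y k | k <- iota 0 (size F).+1] <= size F)%N.
  apply: uniq_leq_size; first by rewrite map_inj_uniq ?iota_uniq.
  by move=> _ /mapP [k _ ->].
by rewrite size_map size_iota ltnn.
Qed.

Definition add_orbit (z : 'cV[R]_d) : seq 'cV[R]_d :=
  F ++ [seq (-1) ^+ nat_of_bool p.1 *: (W w ^+ p.2 *m z) 
    | p : bool * 'I_N <- enum {: bool * 'I_N}].

Lemma orbit_mem z (b : bool) k : P *m z = z ->
  (-1) ^+ b *: (W w ^+ k *m z) \in add_orbit z.
Proof.
move=> Pz; rewrite mem_cat; apply/orP; right; apply/mapP.
exists (b, Ordinal (ltn_pmod k N_gt0)); first by rewrite mem_enum.
congr (_ *: _); rewrite {1}(divn_eq k N) addnC exprD -mulmxE -mulmxA; congr (_ *m _).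
rewrite mulnC exprM; elim: (k %/ N)%N => [|i IH]; first by rewrite mul1mx.
by rewrite exprS -mulmxE -mulmxA IH -[z in LHS]Pz mulmxA (ds_period sys) Pz.
Qed.

Lemma orbit_memP z x : x \in add_orbit z ->
  x \in F \/ exists (b : bool) k, x = (-1) ^+ b *: (W w ^+ k *m z).
Proof.
rewrite mem_cat => /orP[|/mapP [[b k] _ ->]]; [by left|right].
by exists b, k.
Qed.

Lemma comm_power k : P *m W w ^+ k = W w ^+ k *m P.
Proof.
elim: k => [|k IH]; first by rewrite mulmx1 mul1mx.
by rewrite exprS -mulmxE mulmxA -(ds_comm sys) -mulmxA IH mulmxA.
Qed.

Lemma hull_core_orbit z (b : bool) k : hull_seq F z ->
  hull_seq F ((-1) ^+ b *: (W w ^+ k *m z)).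
Proof.
move=> Fz; rewrite -[hull_seq F]dilate1; apply: dilate_sign (cp_opp cp) _.
rewrite dilate1; apply: hull_seq_mulmx Fz; first exact: convex_hull_convex.
by move=> x xF; apply: mem_hull_seq; exact: (stable_power cp).
Qed.

Lemma hull_core0 : hull_seq F 0.
Proof. have [x xF _] := core_neq0 sys cp; exact: hull_seq0 (cp_opp cp) xF. Qed.

Lemma hull_add_orbit_sub c z : 1 <= c -> dilate c (hull_seq F) z ->
  hull_seq (add_orbit z) `<=` dilate c (hull_seq F).
Proof.
move=> c1 [y Fy <-]; have cF := @convex_hull_convex R d [set x | x \in F].
apply: hull_seq_min; first exact: convex_dilate.
move=> x /orbit_memP [xF|[b [k ->]]].
  apply: (@dilate_le _ _ 1) => //; first exact: hull_core0.
  by rewrite dilate1; exact: mem_hull_seq.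
exists ((-1) ^+ b *: (W w ^+ k *m y)); first exact: hull_core_orbit.
by rewrite -scalemxAr scalerA mulrC -scalerA.
Qed.

(** The added points lie in [c] times the old core, so nontrivial words send them into [c * theta]
    times it: a slight enlargement uses up only the slack in [theta]. *)
Lemma add_orbit_core c z : P *m z = z -> 1 <= c -> c * theta < 1 ->
  dilate c (hull_seq F) z -> core_polytope B w P (add_orbit z) (c * theta).
Proof.
move=> Pz c1 ct [y Fy yz].
have c0 : 0 <= c by apply: le_trans c1.
have FE : hull_seq F `<=` hull_seq (add_orbit z).
  by apply: convex_hull_mono => x /= xF; rewrite mem_cat xF.
have cF := @convex_hull_convex R d [set x | x \in F].
have cE := @convex_hull_convex R d [set x | x \in add_orbit z].
split=> //.
- by rewrite mulr_ge0 // (cp_ge0 cp).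
- move=> x /orbit_memP [xF|[b [k ->]]]; first exact: (cp_fix cp).
  by rewrite -scalemxAr mulmxA comm_power -mulmxA Pz.
- move=> x /orbit_memP [xF|[b [k ->]]].
    by rewrite mem_cat (cp_opp cp xF).
  have -> : - ((-1) ^+ b *: (W w ^+ k *m z)) = (-1) ^+ (~~ b) *: (W w ^+ k *m z).
    by rewrite -scaleNr signrN.
  exact: orbit_mem.
- move=> x /orbit_memP [xF|[b [k ->]]].
    by rewrite mem_cat (cp_stable cp xF).
  by rewrite -scalemxAr mulmxA mulmxE -exprS; exact: orbit_mem.
- have core S x : nontrivial w S -> hull_seq F x ->
      dilate theta (hull_seq F) (P *m W S *m x).
    move=> nt; apply: hull_seq_mulmx; first exact: convex_dilate.
    by move=> x' x'F; exact: (cp_contract cp).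
  move=> S x nt /orbit_memP [xF|[b [k ->]]].
    apply: (dilate_sub FE); have := core S x nt (mem_hull_seq xF).
    apply: dilate_le => //; [exact: hull_core0|exact: (cp_ge0 cp)|].
    by rewrite ler_peMl // (cp_ge0 cp).
  have -> : P *m W S *m ((-1) ^+ b *: (W w ^+ k *m z)) =
      c *: (P *m W S *m ((-1) ^+ b *: (W w ^+ k *m y))).
    by rewrite -yz -!scalemxAr !scalerA mulrC.
  rewrite -dilate_dilate; exists (P *m W S *m ((-1) ^+ b *: (W w ^+ k *m y))) => //.
  by apply: (dilate_sub FE); apply: core => //; exact: hull_core_orbit.
- have [r r0 hr] := cp_absorb cp; exists r => // x Px xr.
  by apply: FE; exact: hr.
Qed.

End Homotheties.

Section ManyBodies.
Variables (R : realType) (d' m : nat) (B : 'I_m -> 'M[R]_d'.+1).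
Local Notation d := d'.+1.
Local Notation W := (word_prod B).
Variables (w : seq 'I_m) (P : 'M[R]_d) (N : nat) (C eta : R).
Hypothesis sys : dominated_system B w P N C eta.
Local Notation form := (avg_form (W w) N).
Let N_gt0 := ds_N_gt0 sys.

Lemma hull_core_fix F theta x : core_polytope B w P F theta ->
  hull_seq F x -> P *m x = x.
Proof.
move=> cp; move: x; apply: hull_seq_min; last exact: (cp_fix cp).
by apply/convex_setP => x y t _ _ /= hx hy; rewrite mulmxDr -!scalemxAr hx hy.
Qed.

(** [P] is linear and maps each body onto its core. *)
Lemma core_of_homothety F1 F2 th1 th2 (G1 G2 : set 'cV[R]_d) c :
  core_polytope B w P F1 th1 -> core_polytope B w P F2 th2 ->
  @convex_set R 'cV[R]_d G1 -> @convex_set R 'cV[R]_d G2 ->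
  (forall x, x \in F1 -> G1 x) -> (forall x, x \in F2 -> G2 x) ->
  (forall x, G1 x -> hull_seq F1 (P *m x)) ->
  (forall x, G2 x -> hull_seq F2 (P *m x)) ->
  G1 = dilate c G2 -> hull_seq F1 = dilate c (hull_seq F2).
Proof.
move=> cp1 cp2 cG1 cG2 FG1 FG2 PG1 PG2 G12.
have {}FG1 := hull_seq_min cG1 FG1; have {}FG2 := hull_seq_min cG2 FG2.
apply/seteqP; split=> [x Fx|_ [x Fx <-]].
  have := FG1 _ Fx; rewrite G12 => -[y /PG2 Gy xy]; exists (P *m y) => //.
  by rewrite scalemxAr xy (hull_core_fix cp1).
have : G1 (c *: x) by rewrite G12; exists x => //; exact: FG2.
by move/PG1; rewrite -scalemxAr (hull_core_fix cp2).
Qed.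

(* Enlarging the core by the orbit of [s *: z], for [s] slightly above the last
   multiple of [z] in the core, leaves the maximum of the form unchanged, so that
   a homothety between two of these cores is trivial. *)
Lemma many_bodies F theta : core_polytope B w P F theta ->
  exists G : nat -> set 'cV[R]_d,
  [/\ forall k, symmetric_convex_body (G k),
      forall k, convex_hull (\bigcup_i (mulmx (B i) @` G k)) = G k,
      forall k, hull_of_ellipses (G k) &
      forall k l c, 0 < c -> G k = dilate c (G l) -> k = l].
Proof.
move=> cp; have [x0 [z [x0F hmax Pz nz zM]]] := point_outside_core sys cp.
set M := form x0 x0 in hmax zM.
have cF := @convex_hull_convex R d [set x | x \in F].
have F0 := hull_core0 sys cp.
have orbit_form (b : bool) k : form ((-1) ^+ b *: (W w ^+ k *m z))
    ((-1) ^+ b *: (W w ^+ k *m z)) = form z z.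
  rewrite avg_formZ sqrr_sign mul1r.
  elim: k => [|k IH]; first by rewrite mul1mx.
  rewrite exprS -mulmxE -mulmxA avg_form_invariant //.
  have -> : W w ^+ k *m z = P *m (W w ^+ k *m z).
    by rewrite mulmxA (comm_power sys) -mulmxA Pz.
  by rewrite mulmxA (ds_period sys).
have th0 := cp_ge0 cp; have th1 := cp_lt1 cp.
pose rho := 2 / (1 + theta).
have rho1 : 1 < rho by rewrite ltr_pdivlMr; lra.
have rhot : rho * theta < 1 by rewrite mulrAC ltr_pdivrMr; lra.
have rho0 : 0 < rho by lra.
pose I := [set s : R | 0 <= s /\ hull_seq F (s *: z)].
have I1 s : I s -> s <= 1.
  move=> [s0 Fs]; rewrite leNgt; apply/negP => s1; apply: nz.
  rewrite -[hull_seq F]dilate1; apply: (@dilate_le _ _ s^-1) => //.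
  - by rewrite invr_ge0.
  - by rewrite invf_le1 ?ltW // (lt_trans _ s1).
  - by exists (s *: z); rewrite ?scalerA ?mulVf ?scale1r // gt_eqF // (lt_trans _ s1).
have supI : has_sup I.
  by split; [exists 0; split; rewrite ?scale0r|exists 1 => s /I1].
set t := sup I.
have t1 : t <= 1 by apply: ge_sup => [|s /I1 //]; case: supI.
have z0 : z != 0 by apply: contra_not_neq nz => ->.
have t0 : 0 < t.
  have [r r0 hr] := cp_absorb cp.
  have zn : 0 < `|z| by rewrite normr_gt0.
  apply: (@lt_le_trans _ _ (r / `|z|)); first by rewrite divr_gt0.
  apply: ub_le_sup; first by case: supI.
  split; first by rewrite divr_ge0 // ltW.
  apply: hr; first by rewrite -scalemxAr Pz.
  by rewrite normrZ normrM normfV normr_id divfK ?gt_eqF // gtr0_norm.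
have [s0 Is0 s0t] : exists2 s, I s & t / rho < s.
  have e0 : 0 < t - t / rho by rewrite subr_gt0 ltr_pdivrMr // ltr_pMr.
  by have [s Is] := sup_adherent e0 supI; rewrite subKr; exists s.
have s00 : 0 < s0 by apply: lt_trans s0t; rewrite divr_gt0.
have q0 : 0 < form z z.
  rewrite ltNge; apply/negP => h; case/eqP: z0; exact: avg_form_eq0 h.
pose s2 := Num.sqrt (M / form z z).
have M0 : 0 < M by exact: lt_trans zM.
have s21 : 1 < s2.
  rewrite -sqrtr1 ltr_sqrt; last exact: divr_gt0.
  by rewrite ltr_pdivlMr // mul1r.
have s2M : s2 ^+ 2 * form z z = M.
  by rewrite sqr_sqrtr ?divfK ?gt_eqF // divr_ge0 // ltW.
(* Below the first bound the enlarged core is still contracted; below the second the form of the new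
   points does not exceed [M]. *)
pose u := Num.min (s0 * rho) s2.
have tu : t < u by rewrite lt_min -ltr_pdivrMr // s0t (le_lt_trans t1).
pose s k := t + (u - t) / k.+2%:R.
have st k : t < s k by rewrite ltrDl divr_gt0 // subr_gt0.
have su k : s k < u.
  by rewrite -ltrBrDl ltr_pdivrMr // ltr_pMr ?subr_gt0 // ltr1n.
have Psz k : P *m (s k *: z) = s k *: z by rewrite -scalemxAr Pz.
have szF c k : I c -> 0 < c -> dilate (s k / c) (hull_seq F) (s k *: z).
  by move=> [_ Fc] c0; exists (c *: z); rewrite ?scalerA ?divfK // gt_eqF.
have core k : core_polytope B w P (add_orbit B w N F (s k *: z)) (rho * theta).
  apply: (add_orbit_core sys cp) => //; first exact: ltW.
  apply: (@dilate_le _ _ (s k / s0)) => //; last exact: szF.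
    by rewrite divr_ge0 // ltW // (lt_trans t0).
  by rewrite ler_pdivrMr // mulrC ltW // (lt_le_trans (su k)) // ge_min lexx.
have /choice [G hG] := fun k => polytope_body sys (core k).
have cG k : @convex_set R 'cV[R]_d (G k) by have [[]] := hG k.
exists G; split.
- by move=> k; have [] := hG k.
- by move=> k; have [] := hG k.
- by move=> k; have [] := hG k.
pose H k := hull_seq (add_orbit B w N F (s k *: z)).
have Hform k x : H k x -> form x x <= M.
  move: x; apply: hull_seq_min; first exact: avg_form_convex.
  move=> x /orbit_memP [/hmax //|[b [j ->]]] /=.
  rewrite -scalemxAr scalerA mulrC -scalerA avg_formZ orbit_form -s2M.
  rewrite ler_pM2r // lerXn2r ?nnegrE ?(ltW (lt_trans t0 (st k))) //.
    by rewrite ltW // (lt_trans _ s21).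
  by rewrite ltW // (lt_le_trans (su k)) // ge_min lexx orbT.
have x0H k : H k x0 by apply: mem_hull_seq; rewrite mem_cat x0F.
(* For [c] in [I] close to [t], [H k] lies in [s k / c] times the hull of [F]. If it contained
   [s l *: z], then [c / s k * s l], which exceeds [t], would belong to [I]. *)
have no_lt k l : (s k < s l) -> H k = H l -> False.
  move=> kl Hkl.
  have sk0 := lt_trans t0 (st k); have sl0 := lt_trans t0 (st l).
  have e0 : 0 < t - t * (s k / s l).
    by rewrite subr_gt0 gtr_pMr // ltr_pdivrMr // mul1r.
  have [c Ic] := sup_adherent e0 supI; rewrite subKr => hc.
  have c0 : 0 < c by apply: lt_trans hc; rewrite mulr_gt0 // divr_gt0.
  have ct : c <= t by apply: ub_le_sup => //; case: supI.
  have : H l (s l *: z).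
    apply: mem_hull_seq; have := orbit_mem sys F false 0 (Psz l).
    by rewrite expr0 scale1r mul1mx.
  rewrite -Hkl; have c1 : 1 <= s k / c.
    by rewrite ler_pdivlMr // mul1r (le_trans ct) // ltW.
  move=> /(hull_add_orbit_sub sys cp c1 (szF _ _ Ic c0)) [y Fy yz].
  have : I (c / s k * s l).
    split; first by rewrite !mulr_ge0 ?invr_ge0 // ltW.
    rewrite -scalerA -yz scalerA (_ : _ * _ = 1) ?scale1r //.
    by field; rewrite !gt_eqF.
  move/(ub_le_sup _) => /(_ supI.2); rewrite -/t leNgt => /negP; apply.
  rewrite -ltr_pdivrMr // -ltr_pdivrMr ?invr_gt0 // invrK.
  by rewrite mulrAC -mulrA.
move=> k l c c0 Gkl.
have [bk _ _ FGk PGk] := hG k; have [bl _ _ FGl PGl] := hG l.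
have Hkl : H k = dilate c (H l).
  exact: (core_of_homothety (core k) (core l) (cG k) (cG l) FGk FGl PGk PGl Gkl).
have c0' := ltW c0.
(* Both cores contain [x0], where the form attains their common maximum [M], and the homothety
   multiplies the form by [c ^+ 2]. *)
have c_ge1 : 1 <= c.
  have := x0H k; rewrite Hkl => -[y /Hform yM xy].
  have : M <= c ^+ 2 * M.
    by rewrite {1}/M -xy avg_formZ ler_wpM2l // exprn_ge0 // ltW.
  by move=> h; rewrite -(@ler_pXn2r _ 2) ?nnegrE // expr1n -(ler_pM2r M0) mul1r.
have c_le1 : c <= 1.
  have : H k (c *: x0) by rewrite Hkl; exists x0.
  move/Hform; rewrite avg_formZ -/M -[leRHS]mul1r ler_pM2r // => h.
  by rewrite -(@ler_pXn2r _ 2) ?nnegrE // expr1n.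
have c1 : c = 1 by apply/eqP; rewrite eq_le c_le1.
move: Hkl; rewrite c1 dilate1 => Hkl.
have skl : s k = s l.
  apply/eqP; rewrite eq_le !leNgt; apply/andP; split; apply/negP => h.
    exact: no_lt h (esym Hkl).
  exact: no_lt h Hkl.
move: skl => /addrI /(mulfI _) => /(_ _)/invr_inj/eqP; rewrite eqr_nat => h.
by apply/eqP; move: h; rewrite gt_eqF ?subr_gt0 // => /(_ isT).
Qed.

End ManyBodies.

(** * Normalization and the joint spectral radius *)

Lemma powR_invnX (R : realType) (a : R) n : 0 <= a -> (0 < n)%N ->
  (a `^ n%:R^-1) ^+ n = a.
Proof.
by move=> a0 n0; rewrite -powR_mulrn ?powR_ge0 // -powRrM mulVf ?powRr1 // pnatr_eq0 -lt0n.
Qed.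

Lemma powR_expn_inv (R : realType) (a : R) n : 0 <= a -> (0 < n)%N ->
  (a ^+ n) `^ n%:R^-1 = a.
Proof.
by move=> a0 n0; rewrite -powR_mulrn // -powRrM mulfV ?powRr1 // pnatr_eq0 -lt0n.
Qed.

Lemma cvg_root (R : realType) (c : R) : 0 < c -> (fun n => c `^ n%:R^-1) @ \oo --> (1 : R).
Proof.
move=> c0; rewrite -(cvg_shiftS (fun n => c `^ n%:R^-1)) /=.
have -> : (fun n : nat => c `^ n.+1%:R^-1) = (fun n => expR (n.+1%:R^-1 * ln c)).
  by apply: funext => n; rewrite /powR gt_eqF.
suff : (fun n => expR (n.+1%:R^-1 * ln c)) @ \oo --> expR (0 * ln c).
  by rewrite mul0r expR0.
apply: continuous_cvg; first exact: continuous_expR.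
by apply: cvgM; [exact: cvg_harmonic|exact: cvg_cst].
Qed.

Lemma mxtrace_rotation (R : realType) d' m (B : 'I_m -> 'M[R]_d'.+1) w v k :
  cyclic_perm w v -> \tr (word_prod B (word_power v k)) = \tr (word_prod B w ^+ k).
Proof.
move=> [j ->]; case: k => [|k]; first by rewrite word_prod_nil.
rewrite /rot word_power_rot cat_take_drop !word_prod_cat word_prod_power.
rewrite mulmxA -mulmxA mxtrace_mulC -mulmxA -word_prod_cat cat_take_drop.
by rewrite mulmxE -exprSr.
Qed.

Section Normalization.
Variables (R : realType) (d' m : nat) (A : 'I_m -> 'M[R]_d'.+1).
Local Notation d := d'.+1.
Variables (q : R).
Hypothesis q_gt0 : 0 < q.

Definition rescale (k : 'I_m) : 'M[R]_d := q^-1 *: A k.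

Lemma word_prod_rescale S : word_prod rescale S = q ^- size S *: word_prod A S.
Proof.
elim: S => [|k S IH]; first by rewrite !word_prod_nil expr0 invr1 scale1r.
rewrite !word_prod_cons IH -scalemxAr -scalemxAl scalerA /=; congr (_ *: _).
by rewrite exprSr invfM mulrC.
Qed.

Lemma rescale_irreducible : irreducible_family A -> irreducible_family rescale.
Proof.
move=> irr V hV; apply: irr => k v /(hV k).
rewrite /rescale -scalemxAl => h.
have -> : A k *m v = q *: (q^-1 *: (A k *m v)).
  by rewrite scalerA divff ?scale1r // gt_eqF.
exact: rpredZ.
Qed.

(** The sequence is squeezed between the [n]-th roots of [c] and [C], both multiplied by [q]. *)
Lemma joint_spectral_radius_eq c C : 0 < c -> 0 < C ->
  (forall S, `|word_prod rescale S| <= C) ->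
  (forall n, exists S, size S = n /\ c <= `|word_prod rescale S|) ->
  joint_spectral_radius A = q.
Proof.
move=> c0 C0 hC hc; apply: cvg_lim => //.
have lim1 a : 0 < a -> (fun n => a `^ n%:R^-1 * q) @ \oo --> q.
  move=> a0; have {2}<- : 1 * q = q by rewrite mul1r.
  by apply: cvgM; [exact: cvg_root|exact: cvg_cst].
apply: (squeeze_cvgr _ (lim1 c c0) (lim1 C C0)).
exists 1%N => // n /= n0.
have normE S : `|word_prod A S| = q ^+ size S * `|word_prod rescale S|.
  rewrite word_prod_rescale normrZ gtr0_norm ?invr_gt0 ?exprn_gt0 // mulrA.
  by rewrite divff ?mul1r // gt_eqF // exprn_gt0.
have qn := exprn_ge0 n (ltW q_gt0).
have rootM a : 0 < a -> a `^ n%:R^-1 * q = (a * q ^+ n) `^ n%:R^-1.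
  by move=> a0; rewrite powRM ?(ltW a0) // powR_expn_inv // ltW.
rewrite !rootM //; apply/andP; split.
  have [S [Sn cS]] := hc n.
  apply: (@le_trans _ _ (`|word_prod A S| `^ n%:R^-1)).
    apply: ge0_ler_powR; rewrite ?nnegrE ?invr_ge0 ?mulr_ge0 ?(ltW c0) //.
    by rewrite normE Sn mulrC ler_wpM2l.
  by move: Sn => /eqP Sn; exact: (le_bigmax _ (fun t : n.-tuple 'I_m =>
    `|word_prod A t| `^ n%:R^-1) (Tuple Sn)).
apply/bigmax_leP; split=> [|t _]; first exact: powR_ge0.
apply: ge0_ler_powR; rewrite ?nnegrE ?invr_ge0 ?mulr_ge0 ?(ltW C0) //.
by rewrite normE size_tuple mulrC ler_wpM2r.
Qed.

Lemma rescale_body (G : set 'cV[R]_d) : joint_spectral_radius A = q ->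
  symmetric_convex_body G ->
  convex_hull (\bigcup_k (mulmx (rescale k) @` G)) = G -> invariant_body A G.
Proof.
move=> jsr sG hG; split => //; rewrite jsr -[in RHS]hG.
have AE k x : A k *m x = q *: (rescale k *m x).
  by rewrite /rescale -scalemxAl scalerA divff ?scale1r // gt_eqF.
apply/seteqP; split.
  apply: convex_hull_min; first by apply: convex_dilate; exact: convex_hull_convex.
  move=> _ [k _ [x Gx <-]]; rewrite AE; exists (rescale k *m x) => //.
  by apply: sub_convex_hull; exists k => //; exists x.
move=> _ [x hx <-]; rewrite -mul_scalar_mx; move: x hx.
apply: convex_hull_min; first by apply: convex_preimage; exact: convex_hull_convex.
move=> _ [k _ [x Gx <-]] /=; rewrite mul_scalar_mx -AE.
by apply: sub_convex_hull; exists k => //; exists x.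
Qed.

End Normalization.

Lemma dominated_system_rescale (R : realType) (d' m : nat) (A : 'I_m -> 'M[R]_d'.+1)
    (w : seq 'I_m) (l : R[i]) :
  irreducible_family A -> unique_dominant_product A w ->
  unique_simple_leading (word_prod A w) l -> complex.Im l != 0 ->
  rational_mod_pi_arg l ->
  0 < nu A w /\ exists P N C eta, dominated_system (rescale A (nu A w)) w P N C eta.
Proof.
move=> irr [w0 [primw _] [_ [/(_ w erefl) <- [e [e0 e1 gap]]]]] usl Iml rat.
have {}w0 : w <> [::] by exact: w0.
have {}primw : primitive w by exact: primw.
set q := nu A w in gap *; set r := Normc.normc l.
have n0 : (0 < size w)%N by case: (w) w0.
have [leadl _ _] := usl.
have rE : spectral_radius (word_prod A w) = r by exact: spectral_radius_leading.
have r0 : 0 < r.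
  rewrite lt_neqAle normc_ge0 andbT eq_sym; apply: contraNneq Iml.
  by move/Normc.eq0_normc => ->.
have qE : q = r `^ (size w)%:R^-1 by rewrite /q /nu rE.
have q0 : 0 < q by rewrite qE powR_gt0.
have qn : q ^+ size w = r by rewrite qE powR_invnX // ltW.
split=> //; set B := rescale A q.
have radius_le S : spectral_radius (word_prod B S) <=
    q ^- size S * spectral_radius (word_prod A S).
  by rewrite word_prod_rescale spectral_radiusZ_le // invr_gt0 exprn_gt0.
have radius_gap S : (forall v k, cyclic_perm w v -> S <> word_power v k) ->
    spectral_radius (word_prod B S) <= 1 - e.
  move=> hS; have S0 : S <> [::] by apply: (hS w 0%N); exists 0%N; rewrite rot0.
  have s0 : (0 < size S)%N by case: (S) S0.
  apply: le_trans (radius_le S) _.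
  rewrite mulrC ler_pdivrMr ?exprn_gt0 //.
  have : nu A S <= (1 - e) `^ (size S)%:R^-1 * q.
    by apply: gap => // -[_ [v [k [-> wv]]]]; exact: hS.
  have e1' : 0 <= 1 - e by rewrite subr_ge0 ltW.
  rewrite /nu => h; rewrite -(powR_invnX e1' s0) -exprMn.
  rewrite -(powR_invnX (spectral_radius_ge0 (word_prod A S)) s0).
  rewrite lerXn2r ?nnegrE ?powR_ge0 //.
  by rewrite mulr_ge0 ?powR_ge0 // (ltW q0).
have radius_w : spectral_radius (word_prod B w) <= 1.
  by apply: le_trans (radius_le w) _; rewrite rE qn mulVf // gt_eqF.
have radius0 := @spectral_radius_ge0 R d'.
have trB S : `|\tr (word_prod B S)| <= d'.+1%:R.
  have [[v [k [wv ->]]]|nS] :=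
      pselect (exists v k, cyclic_perm w v /\ S = word_power v k).
    rewrite (mxtrace_rotation _ _ wv) (le_trans (trace_pow_le _ _)) //.
    by rewrite ler_piMr // exprn_ile1.
  have hS v k : cyclic_perm w v -> S <> word_power v k.
    by move=> wv Sv; apply: nS; exists v, k.
  clear radius_w; have := trace_pow_le (word_prod B S) 1; rewrite !expr1 => h; apply: (le_trans h).
  rewrite ler_piMr ?ler0n //; apply: le_trans (radius_gap _ hS) _.
  by rewrite lerBlDr lerDl ltW.
have irrB : irreducible_family B by exact: rescale_irreducible.
have [C C0 hC] := bounded_products irrB trB.
have [N N0 lN] := rational_arg_power rat.
have [P [PP MP MNP limM plane]] := spectral_projection usl Iml lN.
have BE : word_prod B w = r^-1 *: word_prod A w by rewrite word_prod_rescale qn.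
have BkE k : word_prod B w ^+ k = r ^- k *: word_prod A w ^+ k.
  by rewrite BE exprZn exprVn.
have BNP : word_prod B w ^+ N *m P = P.
  by rewrite BkE -scalemxAl MNP scalerA mulVf ?scale1r // gt_eqF // exprn_gt0.
exists P, N, C, (e ^+ d'.+1); split => //.
- by rewrite BE -scalemxAl MP scalemxAr.
- have BNkP k : word_prod B w ^+ (N * k) *m P = P.
    elim: k => [|k IH]; first by rewrite muln0 expr0 mul1mx.
    by rewrite mulnS exprD -mulmxE -mulmxA IH.
  move=> i j; apply/cvgrPdist_le => eps eps0.
  have /cvgrPdist_le /(_ _ eps0) [k0 _ hk0] := limM i j.
  exists k0 => // k /= kk0.
  have {}hk0 := hk0 (N * k)%N (leq_trans kk0 (leq_pmull k N0)).
  have -> : word_prod B w ^+ (N * k) = P + word_prod B w ^+ (N * k) *m (1%:M - P).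
    by rewrite mulmxBr mulmx1 BNkP addrC subrK.
  move: hk0; rewrite scalemxAl -BkE; move: (_ *m (1%:M - P)) => Y.
  by rewrite /= !mxE sub0r opprD addrA subrr sub0r.
- exact: exprn_gt0.
- by move=> S hS; apply: det_one_sub_ge; [exact: radius_gap|exact: ltW].
Qed.

(** A power of [w] that fixes the nonzero matrix [P] is not small, and its part after the first [n]
    letters is bounded by [C], so the product of those [n] letters is bounded below. *)
Lemma dominated_system_lower_bound (R : realType) (d' m : nat) (B : 'I_m -> 'M[R]_d'.+1)
    w P N C eta : dominated_system B w P N C eta ->
  exists2 c, 0 < c & forall n, exists S, size S = n /\ c <= `|word_prod B S|.
Proof.
move=> sys; have C0 := ds_C_gt0 sys.
have d0 : 0 < d'.+1%:R :> R by [].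
exists (d'.+1%:R * (d'.+1%:R * C))^-1 => [|n]; first by rewrite invr_gt0 !mulr_gt0.
have sw : (0 < size w)%N by case: (w) (ds_neq_nil sys).
pose x := word_power w (N * n).
have sx : (n <= size x)%N.
  rewrite size_word_power -mulnA mulnCA; apply: leq_pmulr.
  by rewrite muln_gt0 (ds_N_gt0 sys).
have xP : word_prod B x *m P = P.
  rewrite word_prod_power; elim: (n) => [|k IH]; first by rewrite muln0 expr0 mul1mx.
  by rewrite mulnS exprD -mulmxE -mulmxA IH (ds_period sys).
exists (take n x); split; first by rewrite size_takel.
have P0 : 0 < `|P|.
  rewrite normr_gt0; apply/eqP => P0; have [v1 [v2 [Pv1 _ ind]]] := ds_plane sys.
  have [] := ind 1 0; first by rewrite -Pv1 P0 mul0mx scaler0 scale0r addr0.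
  by move/eqP; rewrite oner_eq0.
have h1 : 1 <= d'.+1%:R * `|word_prod B x|.
  by rewrite -(ler_pM2r P0) mul1r -{1}xP mulmx_norm_le.
have h2 : `|word_prod B x| <= d'.+1%:R * C * `|word_prod B (take n x)|.
  rewrite -{1}(cat_take_drop n x) word_prod_cat (le_trans (mulmx_norm_le _ _)) //.
  rewrite -!mulrA ler_wpM2l // mulrC ler_wpM2r // (ds_norm_le sys) //.
rewrite -[_^-1]mul1r ler_pdivrMr ?mulr_gt0 //; apply: le_trans h1 _.
by rewrite [leRHS]mulrC -[leRHS]mulrA ler_wpM2l.
Qed.

Theorem proposition1 (R : realType) (d m : nat) (A : 'I_m -> 'M[R]_d)
    (w : seq 'I_m) (l : R[i]) :
  (0 < m)%N ->
  irreducible_family A ->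
  unique_dominant_product A w ->
  unique_simple_leading (word_prod A w) l ->
  complex.Im l != 0 ->
  rational_mod_pi_arg l ->
  infinite_set [set homothety_class G | G in [set G | invariant_body A G]] /\
  exists G : set 'cV[R]_d, invariant_body A G /\ hull_of_ellipses G.
Proof.
move=> _; case: d A => [|d'] A irr dom usl Iml rat.
  (* In dimension 0 there are no eigenvectors. *)
  by have [[/eigenvalueP [v _ /eqP[]]]] := usl; rewrite thinmx0.
have [q0 [P [N [C [eta sys]]]]] := dominated_system_rescale irr dom usl Iml rat.
have [c c0 hc] := dominated_system_lower_bound sys.
have jsr := joint_spectral_radius_eq q0 c0 (ds_C_gt0 sys) (ds_norm_le sys) hc.
have [F [theta cp]] := core_polytope_exists sys.
have [G [Gsym Ghull Gell Ghom]] := many_bodies sys cp.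
have Ginv k : invariant_body A (G k) by exact: rescale_body jsr (Gsym k) (Ghull k).
split; last by exists (G 0%N); split.
apply: (@sub_infinite_set _ [set homothety_class (G k) | k in [set: nat]]).
  by move=> _ [k _ <-]; exists (G k) => //; exact: Ginv.
have inj : {in [set: nat] &, injective (fun k => homothety_class (G k))}.
  move=> k k' _ _ /= e.
  have : homothety_class (G k) (G k) by exists 1; rewrite ?ltr01 // dilate1.
  by rewrite e => -[b b0]; exact: Ghom.
rewrite (eq_finite_set (inj_card_eq inj)); exact: infinite_nat.
Qed.
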